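(* Let $S\subset\mathbb{Z}_+$ be a proper cofinite set of positive integers, and for each $n$ let $P_n$ be the uniform probability measure on the set $\Lambda_n$ of $S$-restricted compositions of $n$. For a composition $\vec\lambda=(\lambda_1,\dots,\lambda_\ell)$ let $\mathbf{B}(\vec\lambda)=\prod_{i}\lambda_i$. There exist constants $a_1,b_1>0$ and $a_0,b_0$, and real sequences $\mu_n$ and $\sigma_n>0$ with $\mu_n=a_1n+a_0+o(1)$ and $\sigma_n^2=b_1n+b_0+o(1)$, such that for all real $x$ $$P_n\left(\frac{\log\mathbf{B}-\mu_n}{\sigma_n}\le x\right)=\frac{1}{\sqrt{2\pi}}\int_{-\infty}^{x}e^{-t^2/2}\,dt+O\!\left(\frac{\sqrt[3]{\log n}}{n^{1/6}}\right)$$ as $n\to\infty$, where the implied constant in the error term is uniform in $x$ for $|x|\le\sqrt n$.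
   Context: An $S$-restricted composition of $n$ is a finite sequence $(\lambda_1,\lambda_2,\dots,\lambda_\ell)$ of elements of $S$ with $\lambda_1+\dots+\lambda_\ell=n$. ''Proper cofinite'' means $\mathbb{Z}_+\setminus S$ is finite and nonempty. *)

(* Defs.v *)
From mathcomp Require Import all_boot all_order all_algebra.
From mathcomp Require Import finmap.
From mathcomp Require Import all_classical all_reals all_analysis.

Set Implicit Arguments.
Unset Strict Implicit.
Unset Printing Implicit Defensive.

Import Order.TTheory GRing.Theory Num.Theory.
Import numFieldNormedType.Exports.

Local Open Scope classical_set_scope.
Local Open Scope ring_scope.

Definition posnat : set nat := [set k | (0 < k)%N].

Definition proper_cofinite (S : set nat) : Prop :=
  [/\ S `<=` posnat, finite_set (posnat `\` S) & posnat `\` S !=set0].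

Definition compositions (S : set nat) (n : nat) : set (seq nat) :=
  [set l | (forall k, k \in l -> S k) /\ sumn l = n].

Lemma finite_compositions (S : set nat) (n : nat) :
  S `<=` posnat -> finite_set (compositions S n).
Proof.
move=> S_gt0; pose f (t : n.-bseq 'I_n.+1) : seq nat := map val t.
apply: (@sub_finite_set _ _ (f @` setT)); last exact/finite_image/finite_finset.
move=> l [lS ln].
have l_gt0 k : k \in l -> (0 < k)%N by move=> /lS /S_gt0.
have szl : (size l <= n)%N.
  rewrite -ln; elim: l l_gt0 {lS ln} => //= k l IH kl.
  rewrite -add1n leq_add ?kl ?mem_head// IH// => j jl.
  by rewrite kl// inE jl orbT.
have l_le k : k \in l -> (k < n.+1)%N.
  rewrite ltnS -ln; elim: l {lS ln l_gt0 szl} => //= j l IH.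
  rewrite inE => /predU1P[->|/IH kl]; first exact: leq_addr.
  exact/(leq_trans kl)/leq_addl.
have szm : (size [seq inord k : 'I_n.+1 | k <- l] <= n)%N by rewrite size_map.
exists (Bseq szm) => //; rewrite /f /= -map_comp -[RHS]map_id.
by apply/eq_in_map => k /l_le kn /=; rewrite inordK.
Qed.

(* Only meaningful when [A] is finite and nonempty: [fset_set] sends infinite
   sets to the empty one, and division by 0 yields 0. *)
Definition uniform_on (R : realType) (T : choiceType) (A E : set T) : R :=
  #|` fset_set (A `&` E)|%:R / #|` fset_set A|%:R.

Definition prodparts (l : seq nat) : nat := (\prod_(k <- l) k)%N.

Definition std_normal_cdf (R : realType) (x : R) : R :=
  (Num.sqrt (2 * pi))^-1 *
  (\int[@lebesgue_measure R]_(t in `]-oo, x]) expR (- t ^+ 2 / 2)).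

(* Main.v *)
Require Import Defs.
From HB Require Import structures.
From mathcomp Require Import all_boot all_order all_algebra.
From mathcomp Require Import finmap.
From mathcomp Require Import all_classical all_reals all_analysis.
From mathcomp Require Import lra zify.

(** Let [r] be the root in (0, 1) of the equation sum_(k in S) r^k = 1.  Giving
    weight [p k = r^k] to the parts [k] of [S] turns a uniform composition of [n]
    into a renewal process with steps X of law [p], conditioned to renew at [n].
    With a = E[ln X] / E[X] the variables Y = ln X - a X are centred and
    ln B - a n is the sum W of the Y's; one can take mu_n = a n and
    sigma_n^2 = sg n with sg = E[Y^2] / E[X].

    Let Phi be the normal distribution function and let F_n(w) be the expectation
    of Phi((w - W) / s0) on the event that [n] is a renewal epoch, so that
    F_n(w) = sum_k p_k F_(n-k)(w - Y_k).  By a Taylor expansion and the choice of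
    [a] and [sg], the Gaussian G_n(w) = Phi(w / sqrt(s0^2 + sg n)) satisfies the
    same equation up to defects whose sum is O(1/s0) and a boundary term
    P(X > n) G_0(w).  Hence sum_(i <= n) P(X > i) F_(n-i)(w) = G_n(w) + O(1/s0).
    A Doeblin contraction for the age of the renewal process shows that F_(n-i)
    is close to F_n, so that the left-hand side is close to E[X] F_n(w).  The same
    argument gives E[X] P(n is a renewal epoch) = 1 + O(1/n), and the
    smoothing by Phi(. / s0) is undone with s0 = n^(1/4). *)

Set Implicit Arguments.
Unset Strict Implicit.
Unset Printing Implicit Defensive.

Import Order.TTheory GRing.Theory Num.Theory.
Import numFieldNormedType.Exports.

Local Open Scope classical_set_scope.
Local Open Scope ring_scope.

(** * The standard normal distribution function *)

Section StdNormal.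
Variable R : realType.
Implicit Types x y z c d : R.
Local Notation Phi := (@std_normal_cdf R).

Definition std_normal_pdf x : R := (Num.sqrt (2 * pi))^-1 * expR (- x ^+ 2 / 2).
Local Notation phi := std_normal_pdf.

Lemma std_normal_pdfE x : phi x = normal_pdf 0 1 x.
Proof.
rewrite normal_pdfE ?oner_neq0// /phi /normal_peak /normal_fun subr0.
by rewrite expr1n mul1r -[pi *+ 2]mulr_natl.
Qed.

Lemma sqrt2pi_gt1 : 1 < Num.sqrt (2 * pi) :> R.
Proof.
rewrite -[ltLHS]sqrtr1 ltr_sqrt; last by rewrite mulr_gt0// pi_gt0.
have := @pi_ge2 R; lra.
Qed.

Lemma std_normal_pdf_integrable x :
  (@lebesgue_measure R).-integrable `]-oo, x] (EFin \o phi).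
Proof.
apply: (@integrableS _ _ _ _ setT) => //.
have := @integrable_normal_pdf R 0 1.
by apply: eq_integrable => // t _ /=; rewrite std_normal_pdfE.
Qed.

Lemma std_normal_cdf_Rintegral x :
  Phi x = \int[lebesgue_measure]_(t in `]-oo, x]) phi t.
Proof.
rewrite /Phi /std_normal_cdf -RintegralZl//.
have /(_ (measurable_itv _)) := fun mD => integrableZl mD (Num.sqrt (2 * pi))
  (std_normal_pdf_integrable x).
apply: eq_integrable => // t _ /=.
rewrite -EFinM /phi mulrA divff ?mul1r//.
by rewrite gt_eqF// (lt_trans ltr01 sqrt2pi_gt1).
Qed.

Lemma std_normal_cdfE x : (Phi x)%:E = normal_prob 0 1 `]-oo, x].
Proof.
rewrite std_normal_cdf_Rintegral /Rintegral fineK.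
  by apply: eq_integral => t _; rewrite -std_normal_pdfE.
exact: integrable_fin_num (std_normal_pdf_integrable x).
Qed.

Lemma std_normal_cdf_ge0 x : 0 <= Phi x.
Proof. by rewrite -lee_fin std_normal_cdfE; exact: measure_ge0. Qed.

Lemma std_normal_cdf_le1 x : Phi x <= 1.
Proof. by rewrite -lee_fin std_normal_cdfE; exact: probability_le1. Qed.

(** The identity as a random variable: under the normal law its distribution function is [Phi],
    which yields the limits at both infinities. *)
Let idR : measurableTypeR R -> R := idfun.
HB.instance Definition _ :=
  @isMeasurableFun.Build _ _ _ _ idR (@measurable_id _ _ setT).

Lemma std_normal_cdf_cdf :
  EFin \o Phi = cdf (idR : {RV (normal_prob (0:R) 1) >-> R}).
Proof. by apply/funext => x /=; rewrite std_normal_cdfE. Qed.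

Lemma cvg_std_normal_cdfy : Phi x @[x --> +oo] --> (1 : R).
Proof.
apply: (@fine_cvg _ _ _ _ (EFin \o Phi)).
rewrite std_normal_cdf_cdf; exact: cvg_cdfy1.
Qed.

Lemma cvg_std_normal_cdfNy : Phi x @[x --> -oo] --> (0 : R).
Proof.
apply: (@fine_cvg _ _ _ _ (EFin \o Phi)).
rewrite std_normal_cdf_cdf; exact: cvg_cdfNy0.
Qed.

Lemma continuous_std_normal_pdf : continuous phi.
Proof.
rewrite (_ : phi = normal_pdf 0 1); last by apply/funext => x; rewrite std_normal_pdfE.
by apply: continuous_normal_pdf; rewrite oner_neq0.
Qed.

Lemma is_derive_std_normal_cdf x : is_derive x 1 Phi (phi x).
Proof.
(* Ending the half-line at [x + 1] makes [x] an interior point, as the fundamental theorem of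
   calculus requires. *)
have x1 : x < x + 1 by rewrite ltrDl.
have /(@continuous_FTC1 R phi -oo%O x (x+1) x1)[||d e] :
    lebesgue_measure.-integrable [set` Interval -oo%O (BRight (x + 1))] (EFin \o phi).
- exact: std_normal_pdf_integrable.
- by rewrite ltNyr.
- exact: continuous_std_normal_pdf.
rewrite (_ : Phi = fun y => \int[lebesgue_measure]_(t in `]-oo, y]) phi t); last first.
  by apply/funext => y; rewrite std_normal_cdf_Rintegral.
by split => //; rewrite -derive1E.
Qed.

Lemma is_derive_std_normal_pdf x : is_derive x 1 phi (- (x * phi x)).
Proof.
rewrite /phi; apply: is_derive_eq.
rewrite /GRing.scale/= -?exprVn; set s := Num.sqrt _; set e := expR _; lra.
Qed.

Lemma std_normal_pdf_ge0 x : 0 <= phi x.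
Proof. by rewrite mulr_ge0 ?expR_ge0// invr_ge0. Qed.

(** [expR (x ^+ 2 / 2)] is the square of [expR (x ^+ 2 / 4)], and [1 + u <= expR u]; the normalising
    factor is below 1. *)
Lemma std_normal_pdf_decay x : (1 + x ^+ 2 / 4) ^+ 2 * phi x <= 1.
Proof.
have c1 : (Num.sqrt (2 * pi))^-1 <= 1 :> R.
  by rewrite invf_le1 ?(ltW sqrt2pi_gt1) ?(lt_trans ltr01 sqrt2pi_gt1).
have x0 : 0 <= 1 + x ^+ 2 / 4 by have := sqr_ge0 x; lra.
have e1 : (1 + x ^+ 2 / 4) ^+ 2 * expR (- x ^+ 2 / 2) <= 1.
  have -> : - x ^+ 2 / 2 = - (x ^+ 2 / 4 + x ^+ 2 / 4) by lra.
  rewrite expRN ler_pdivrMr ?expR_gt0// mul1r expRD -expr2.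
  by rewrite ler_pXn2r ?nnegrE ?expR_ge0//; exact: expR_ge1Dx.
rewrite /phi mulrCA -[leRHS]mulr1 ler_pM ?invr_ge0 ?sqrtr_ge0//.
by rewrite mulr_ge0 ?expR_ge0 ?exprn_ge0.
Qed.

(** The even moments come from expanding the decay bound. The odd ones are interpolated between them
    by squares times the density. *)
Lemma std_normal_pdf_moments x :
  [/\ phi x <= 1, `|x| * phi x <= 1, x ^+ 2 * phi x <= 2 & `|x| ^+ 3 * phi x <= 16].
Proof.
have p0 := std_normal_pdf_ge0 x; have := std_normal_pdf_decay x.
have a0 := normr_ge0 x; have : x ^+ 2 = `|x| ^+ 2 by rewrite real_normK ?num_real.
move=> ->; set a := `|x| in a0 *; set p := phi x in p0 *; move=> h.
have ap : 0 <= a * p by rewrite mulr_ge0.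
have a2p : 0 <= a ^+ 2 * p by rewrite mulr_ge0// exprn_ge0.
have a3p : 0 <= a ^+ 3 * p by rewrite mulr_ge0// exprn_ge0.
have a4p : 0 <= a ^+ 4 * p by rewrite mulr_ge0// exprn_ge0.
have h1 : 0 <= (a / 2 - 1) ^+ 2 * p by rewrite mulr_ge0// sqr_ge0.
have h2 : 0 <= (a ^+ 2 / 4 - 1) ^+ 2 * p by rewrite mulr_ge0// sqr_ge0.
have h3 : 0 <= (a / 2 - 1) ^+ 2 * (a ^+ 2 * p) by rewrite mulr_ge0// sqr_ge0.
by split; lra.
Qed.

Lemma is_derive_idM_std_normal_pdf x :
  is_derive x 1 (fun y => y * phi y) ((1 - x ^+ 2) * phi x).
Proof.
have h := is_derive_std_normal_pdf x.
apply: is_derive_eq; rewrite /GRing.scale/=; lra.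
Qed.

End StdNormal.

(** The endpoints may come in either order, because the displacements to which this is applied have
    no fixed sign. *)
Lemma ler_dist_MVT (R : realType) (f df : R -> R) (M a b : R) :
  (forall x, Num.min a b <= x <= Num.max a b -> is_derive x 1 f (df x)) ->
  (forall x, Num.min a b <= x <= Num.max a b -> `|df x| <= M) ->
  `|f b - f a| <= M * `|b - a|.
Proof.
wlog ab : a b / a <= b => [H|].
  case/orP: (le_total a b) => [ab|ba]; first exact: H.
  move=> fD dfM; rewrite (distrC (f b)) (distrC b).
  by apply: H ba _ _ => x; rewrite minC maxC; [exact: fD|exact: dfM].
rewrite (min_idPl ab) (max_idPr ab) => fD dfM.
have fD' x : x \in `]a, b[ -> is_derive x 1 f (df x).
  by rewrite in_itv/= => /andP[ax xb]; apply: fD; rewrite !ltW.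
have cf : {within `[a, b], continuous f}.
  apply: derivable_within_continuous => x; rewrite in_itv/= => xab.
  by have [] := fD _ xab.
have [x xab ->] := MVT_segment ab fD' cf.
by rewrite normrM ler_wpM2r// dfM// (itvP xab).
Qed.

(** * Lipschitz, Taylor and tail bounds for the normal distribution function *)

Section StdNormalTaylor.
Variable R : realType.
Implicit Types x y z c d : R.
Local Notation Phi := (@std_normal_cdf R).
Local Notation phi := (@std_normal_pdf R).

Lemma std_normal_cdf_lip x y : `|Phi x - Phi y| <= `|x - y|.
Proof.
rewrite -[leRHS]mul1r; apply: (@ler_dist_MVT _ Phi phi) => t _.
  exact: is_derive_std_normal_cdf.
rewrite ger0_norm ?std_normal_pdf_ge0//; by have [] := std_normal_pdf_moments t.
Qed.

Lemma std_normal_cdf_nd x y : x <= y -> Phi x <= Phi y.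
Proof.
move=> xy; rewrite -lee_fin !std_normal_cdfE le_measure ?inE//; exact: subitvPr.
Qed.

Lemma idM_std_normal_pdf_lip x y : `|x * phi x - y * phi y| <= 3 * `|x - y|.
Proof.
apply: (@ler_dist_MVT _ (fun y => y * phi y) (fun x => (1 - x ^+ 2) * phi x)) => t _.
  exact: is_derive_idM_std_normal_pdf.
have p0 := std_normal_pdf_ge0 t.
have [h0 _ h2 _] := std_normal_pdf_moments t.
have t2 : 0 <= t ^+ 2 * phi t by rewrite mulr_ge0// sqr_ge0.
rewrite ler_norml; lra.
Qed.

(** Two integrations of the Lipschitz bound for [y * phi y]: the remainder [f0] has derivative [f1],
    whose own derivative is an increment of that function. *)
Lemma std_normal_cdf_Taylor3 z d :
  `|Phi (z + d) - Phi z - d * phi z + d ^+ 2 / 2 * (z * phi z)| <= 3 * `|d| ^+ 3.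
Proof.
pose f1 (t : R) := phi (z + t) - phi z + t * (z * phi z).
pose f0 (t : R) := Phi (z + t) - Phi z - t * phi z + t ^+ 2 / 2 * (z * phi z).
have df1 (t : R) : is_derive t 1 f1 (z * phi z - (z + t) * phi (z + t)).
  have h := is_derive_std_normal_pdf (z + t).
  apply: is_derive_eq; rewrite /GRing.scale/= /f1 /std_normal_pdf; lra.
have df0 (t : R) : is_derive t 1 f0 (f1 t).
  have h := is_derive_std_normal_cdf (z + t).
  apply: is_derive_eq; rewrite /GRing.scale/= /f1 /std_normal_pdf; lra.
have bnd (t x : R) : Num.min 0 t <= x <= Num.max 0 t -> `|x| <= `|t|.
  case/orP: (le_total 0 t) => t0; rewrite ?(min_idPl t0) ?(max_idPr t0)
    ?(min_idPr t0) ?(max_idPl t0) => /andP[h1 h2].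
    by rewrite !ger0_norm// (le_trans h1).
  by rewrite !ler0_norm ?lerN2// (le_trans h1).
have b1 t : `|f1 t| <= 3 * `|t| ^+ 2.
  have -> : f1 t = f1 t - f1 0 by rewrite /f1 addr0; lra.
  rewrite -[t in leRHS]subr0 expr2 mulrA.
  apply: (ler_dist_MVT (fun x _ => df1 x)) => x /bnd xt.
  rewrite (le_trans (idM_std_normal_pdf_lip _ _))// opprD addNKr normrN.
  by rewrite ler_pM2l// subr0.
rewrite -[leLHS]/`|f0 d|.
have -> : f0 d = f0 d - f0 0 by rewrite /f0 addr0; lra.
rewrite -[d in leRHS]subr0 exprSr mulrA.
apply: (ler_dist_MVT (fun x _ => df0 x)) => x /bnd xt.
rewrite (le_trans (b1 _))// ler_pM2l// subr0 ler_pXn2r//.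
Qed.

(** The same scheme in the scale [t], from 1 to [c]. For [t >= 1] the second derivative is at most
    [|z t|^3 phi (z t) <= 16] in absolute value, uniformly in [z]. *)
Lemma std_normal_cdf_scale_Taylor2 z c : 1 <= c ->
  `|Phi (z * c) - Phi z - (c - 1) * (z * phi z)| <= 16 * (c - 1) ^+ 2.
Proof.
move=> c1.
pose f1 (t : R) := z * phi (z * t) - z * phi z.
pose f0 (t : R) := Phi (z * t) - Phi z - (t - 1) * (z * phi z).
have df1 (t : R) : is_derive t 1 f1 (- (z ^+ 3 * t * phi (z * t))).
  have h := is_derive_std_normal_pdf (z * t).
  apply: is_derive_eq; rewrite /GRing.scale/= /std_normal_pdf; lra.
have df0 (t : R) : is_derive t 1 f0 (f1 t).
  have h := is_derive_std_normal_cdf (z * t).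
  apply: is_derive_eq; rewrite /GRing.scale/= /f1 /std_normal_pdf; lra.
have b1 t : 1 <= t -> `|f1 t| <= 16 * (t - 1).
  move=> t1; have -> : f1 t = f1 t - f1 1 by rewrite /f1 mulr1; lra.
  rewrite -[t - 1 in leRHS]ger0_norm ?subr_ge0//.
  apply: (ler_dist_MVT (fun x _ => df1 x)) => x.
  rewrite (min_idPl t1) (max_idPr t1) => /andP[x1 _].
  have x0 : 0 <= x by rewrite (le_trans ler01).
  rewrite normrN 2!normrM normrX (ger0_norm x0) (ger0_norm (std_normal_pdf_ge0 _)).
  have [_ _ _] := std_normal_pdf_moments (z * x).
  apply: le_trans; rewrite ler_wpM2r ?std_normal_pdf_ge0//.
  rewrite normrM exprMn (ger0_norm x0) ler_wpM2l ?exprn_ge0//.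
  by rewrite -[leLHS]expr1 ler_weXn2l.
rewrite -[leLHS]/`|f0 c|.
have -> : f0 c = f0 c - f0 1 by rewrite /f0 mulr1; lra.
rewrite expr2 mulrA -[c - 1 in X in _ * X]ger0_norm ?subr_ge0//.
apply: (ler_dist_MVT (fun x _ => df0 x)) => x.
rewrite (min_idPl c1) (max_idPr c1) => /andP[x1 xc].
rewrite (le_trans (b1 _ x1))//; lra.
Qed.

Lemma std_normal_cdf_scale_lip z c : 1 <= c -> `|Phi (z * c) - Phi z| <= c - 1.
Proof.
move=> c1; rewrite -[c - 1]ger0_norm ?subr_ge0// -[leRHS]mul1r.
rewrite -{2}[z]mulr1.
have d (t : R) : is_derive t 1 (fun t => Phi (z * t)) (z * phi (z * t)).
  have h := is_derive_std_normal_cdf (z * t).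
  apply: is_derive_eq; rewrite /GRing.scale/= /std_normal_pdf; lra.
apply: (ler_dist_MVT (fun x _ => d x)) => x.
rewrite (min_idPl c1) (max_idPr c1) => /andP[x1 xc].
rewrite normrM (ger0_norm (std_normal_pdf_ge0 _)).
have [_ h _ _] := std_normal_pdf_moments (z * x).
apply: le_trans h; rewrite ler_wpM2r ?std_normal_pdf_ge0// normrM.
by rewrite ler_peMr// ger0_norm// (le_trans ler01).
Qed.

Lemma is_derive_inv_sqr x : 0 < x -> is_derive x 1 (fun t => 8 / t ^+ 2) (- 16 / x ^+ 3).
Proof.
move=> x0; have x2 : x ^+ 2 != 0 by rewrite expf_neq0// gt_eqF.
have h : is_derive x 1 (fun t : R => t ^+ 2) (2 * x).
  apply: is_derive_eq; rewrite /GRing.scale/=; lra.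
have h' := @is_deriveV R (fun t => t ^+ 2) x (2 * x) 1 x2 h.
apply: is_derive_eq; rewrite /GRing.scale/= .
have : x^-1 * x = 1 by rewrite mulVf// gt_eqF.
rewrite -!exprVn; set y := x^-1 => xy.
have -> : 8 * (- y ^+ 2 ^+ 2 * (2 * x)) = - 16 * y ^+ 3 * (y * x) by lra.
by rewrite xy mulr1.
Qed.

(** [phi x <= 16 / x^3], and the right-hand side is minus the derivative of [8 / x^2]; the
    comparison is carried from [c] to infinity. *)
Lemma std_normal_cdf_tail c : 0 < c ->
  1 - Phi c <= 8 / c ^+ 2 /\ Phi (- c) <= 8 / c ^+ 2.
Proof.
move=> c0.
(* [f + 8 / t^2] is nonincreasing. This serves [Phi] for the upper tail and [- Phi (- x)] for the
   lower one. *)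
have key (f df : R -> R) : (forall x, 0 < x -> is_derive x 1 f (df x)) ->
    (forall x, 0 < x -> `|df x| <= 16 / x ^+ 3) ->
    forall y, c <= y -> f y - f c <= 8 / c ^+ 2.
  move=> fd dfb y cy.
  pose g t := f t + 8 / t ^+ 2.
  have gd x : 0 < x -> is_derive x 1 g (df x - 16 / x ^+ 3).
    move=> x0; have h1 := fd _ x0; have h2 := is_derive_inv_sqr x0.
    apply: is_derive_eq; lra.
  have gd' x : x \in `]c, y[ -> is_derive x 1 g (df x - 16 / x ^+ 3).
    by rewrite in_itv/= => /andP[cx _]; apply: gd; rewrite (lt_trans c0).
  have cg : {within `[c, y], continuous g}.
    apply: derivable_within_continuous => x; rewrite in_itv/= => /andP[cx _].
    by have [] := gd _ (lt_le_trans c0 cx).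
  have [x xcy e] := MVT_segment cy gd' cg.
  have x0 : 0 < x by rewrite (lt_le_trans c0)// (itvP xcy).
  have : g y - g c <= 0.
    rewrite e mulr_le0_ge0 ?subr_ge0// subr_le0.
    exact: le_trans (ler_norm _) (dfb _ x0).
  have : 0 <= 8 / y ^+ 2 by rewrite divr_ge0// exprn_ge0// ltW// (lt_le_trans c0).
  rewrite /g; lra.
have pb x : 0 < x -> `|phi x| <= 16 / x ^+ 3.
  move=> x0; rewrite ler_pdivlMr ?exprn_gt0// mulrC.
  rewrite ger0_norm ?std_normal_pdf_ge0// -{1}(gtr0_norm x0).
  by have [] := std_normal_pdf_moments x.
split.
  rewrite lerBlDr addrC; apply: (cvgr_to_le (@cvg_std_normal_cdfy R)).
  near=> y; rewrite -lerBlDl; apply: (key Phi phi) => //.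
  by move=> x _; exact: is_derive_std_normal_cdf.
rewrite -subr_le0 -oppr_ge0 opprB.
have cv : Phi x + (8 / c ^+ 2 - Phi (- c)) @[x --> -oo] --> 0 + (8 / c ^+ 2 - Phi (- c)).
  by apply: cvgD; [exact: cvg_std_normal_cdfNy|exact: cvg_cst].
rewrite -[leRHS]add0r; apply: (cvgr_to_ge cv); near=> y.
have cy : c <= - y by rewrite lerNr.
have := key (fun x => - Phi (- x)) (fun x => phi (- x)) _ _ _ cy.
rewrite opprK => H.
have {H} : - Phi y - - Phi (- c) <= 8 / c ^+ 2; last lra.
apply: H => x x0.
  have h := is_derive_std_normal_cdf (- x).
  apply: is_derive_eq; rewrite /GRing.scale/=; lra.
rewrite (_ : phi (- x) = phi x); last by rewrite /std_normal_pdf sqrrN.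
exact: pb.
Unshelve. all: by end_near. Qed.

End StdNormalTaylor.

(** * One-step expansion of a Gaussian profile *)

Section GaussStep.
Variable R : realType.
Implicit Types w y s k sg : R.
Local Notation Phi := (@std_normal_cdf R).
Local Notation phi := (@std_normal_pdf R).

(* Second-order expansion of [Phi (w / s)] under a joint change of the location
   [w] and of the variance [s ^+ 2]; the location is moved first. *)
Lemma std_normal_cdf_step w y s s' k sg : 0 <= sg -> 0 <= k -> 1 <= s' -> 0 < s ->
  s ^+ 2 = s' ^+ 2 + sg * k ->
  `|Phi ((w - y) / s') - (Phi (w / s) - y * (phi (w / s) / s)
      - (y ^+ 2 - sg * k) * ((w / s) * phi (w / s) / (2 * s ^+ 2)))|
  <= (3 * `|y| ^+ 3 + 18 * (sg * k * (1 + sg * k)) ^+ 2 + 2 * (sg * k * `|y|)) / s ^+ 3.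
Proof.
move=> sg0 k0 s'1 s0 ss'.
have v0 : 0 <= sg * k by rewrite mulr_ge0.
have s'0 : 0 < s' by lra.
have s1 : 1 <= s.
  rewrite -(@ler_pXn2r _ 2) ?nnegrE ?(ltW s0)// expr1n ss'.
  have := sqr_ge0 (s' - 1); lra.
move: (sg * k) v0 ss' => v v0 ss'.
pose i := s^-1; pose c := s / s'; pose z := w / s; pose z' := (w - y) / s.
have i0 : 0 < i by rewrite invr_gt0.
have i1 : i <= 1 by rewrite invf_le1.
have is1 : i * s = 1 by rewrite mulVf// gt_eqF.
have cs' : c * s' = s by rewrite divfK// gt_eqF.
have ss : s' <= s by rewrite -(@ler_pXn2r _ 2) ?nnegrE ?(ltW s0) ?(ltW s'0)// ss'; lra.
have c1 : 1 <= c by rewrite ler_pdivlMr// mul1r.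
have z'c : (w - y) / s' = z' * c.
  by rewrite /z' /c mulrA divfK// gt_eqF.
have ci : 1 - (c^-1) ^+ 2 = v * i ^+ 2.
  rewrite /c invf_div -/i exprMn -(expr1n _ 2) -is1 !exprMn -/i.
  rewrite ss' -/i; lra.
have c0 : 0 < c by lra.
have cV : c^-1 * c = 1 by rewrite mulVf// gt_eqF.
have cV1 : c^-1 <= 1 by rewrite invf_le1.
have cV0 : 0 < c^-1 by rewrite invr_gt0.
(* [c - 1 <= c^2 - 1 = v / s'^2], and [s' >= 1] gives [s^2 <= s'^2 (1 + v)]. *)
have cb : c - 1 <= v * (1 + v) * i ^+ 2.
  have h1 : (c ^+ 2 - 1) * s' ^+ 2 = v.
    have := ss'; rewrite -{1}cs' exprMn; lra.
  have h2 : c - 1 <= c ^+ 2 - 1 by have := sqr_ge0 (c - 1); lra.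
  have s'2 : 1 <= s' ^+ 2 by have := sqr_ge0 (s' - 1); lra.
  have h3 : s ^+ 2 <= s' ^+ 2 * (1 + v).
    have : 0 <= v * (s' ^+ 2 - 1) by rewrite mulr_ge0// subr_ge0.
    rewrite ss'; lra.
  have : (c ^+ 2 - 1) * s ^+ 2 <= v * (1 + v).
    rewrite -{1}h1 -mulrA ler_wpM2l//; lra.
  move=> h4; apply: (le_trans h2).
  have -> : c ^+ 2 - 1 = (c ^+ 2 - 1) * s ^+ 2 * i ^+ 2.
    by rewrite -mulrA -exprMn (mulrC s) is1 expr1n mulr1.
  by rewrite ler_wpM2r// exprn_ge0// ltW.
have cb2 : (c - 1) ^+ 2 <= (v * (1 + v)) ^+ 2 * i ^+ 3.
  have : (c - 1) ^+ 2 <= (v * (1 + v) * i ^+ 2) ^+ 2.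
    by rewrite ler_pXn2r ?nnegrE//; [lra|apply: le_trans cb; lra].
  move=> /le_trans; apply; rewrite exprMn ler_wpM2l ?sqr_ge0//.
  by rewrite -exprM ler_wiXn2l// ltW.
(* The difference is exactly [(c - 1)^2 (1 / c + 1 / (2 c^2))], and [c >= 1]. *)
have cc : `|(c - 1) - v * i ^+ 2 / 2| <= 3 / 2 * (c - 1) ^+ 2.
  rewrite -ci.
  have -> : c - 1 - (1 - c^-1 ^+ 2) / 2 = (c - 1) ^+ 2 * (c^-1 + c^-1 ^+ 2 / 2).
    move: cV; set d := c^-1 => cV.
    have -> : (c - 1) ^+ 2 * (d + d ^+ 2 / 2) =
      (d * c) * c - 2 * (d * c) + d + (d * c) ^+ 2 / 2 - (d * c) * d + d ^+ 2 / 2 by lra.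
    rewrite cV; lra.
  rewrite ger0_norm; last by rewrite mulr_ge0 ?sqr_ge0//; nra.
  rewrite mulrC ler_wpM2r ?sqr_ge0//; nra.
have t1 := std_normal_cdf_Taylor3 z (- (y * i)).
have t2 := std_normal_cdf_scale_Taylor2 z' c1.
have zz' : z' = z - y * i by rewrite /z' mulrBl.
have t3 := idM_std_normal_pdf_lip z' z.
have t4 : `|z' * phi z'| <= 1.
  have [_ h _ _] := std_normal_pdf_moments z'.
  by rewrite normrM (ger0_norm (std_normal_pdf_ge0 _)).
rewrite z'c -/z -/i -zz' in t1 *.
have -> : z * phi z / (2 * s ^+ 2) = z * phi z * i ^+ 2 / 2.
  rewrite invfM -exprVn -/i; lra.
rewrite -exprVn -/i.
(* Four errors: the location shift, the change of scale, the replacement of [c - 1] by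
   [v / (2 s^2)], and the return from [z'] to [z] in the variance term. *)
pose E1 := Phi z' - Phi z - - (y * i) * phi z + (- (y * i)) ^+ 2 / 2 * (z * phi z).
pose E2 := Phi (z' * c) - Phi z' - (c - 1) * (z' * phi z').
pose E3 := (c - 1 - v * i ^+ 2 / 2) * (z' * phi z').
pose E4 := v * i ^+ 2 / 2 * (z' * phi z' - z * phi z).
have -> : Phi (z' * c) - (Phi z - y * (phi z * i)
    - (y ^+ 2 - v) * (z * phi z * i ^+ 2 / 2)) = E1 + E2 + E3 + E4.
  rewrite /E1 /E2 /E3 /E4; lra.
have b1 : `|E1| <= 3 * `|y| ^+ 3 * i ^+ 3.
  rewrite (le_trans t1)// normrN normrM (gtr0_norm i0) exprMn; lra.
have b2 : `|E2| <= 16 * ((v * (1 + v)) ^+ 2 * i ^+ 3).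
  by rewrite (le_trans t2)// ler_pM2l.
have b3 : `|E3| <= 3 / 2 * ((v * (1 + v)) ^+ 2 * i ^+ 3).
  rewrite normrM -[leRHS]mulr1 ler_pM//.
  by rewrite (le_trans cc)// ler_pM2l//; lra.
have b4 : `|E4| <= 2 * (v * `|y|) * i ^+ 3.
  have h : 0 <= v * i ^+ 2 / 2 by rewrite divr_ge0// mulr_ge0// exprn_ge0// ltW.
  rewrite normrM ger0_norm//.
  have : `|z' * phi z' - z * phi z| <= 3 * (`|y| * i).
    by rewrite (le_trans t3)// zz' addrC addKr normrN normrM (gtr0_norm i0).
  move=> /(ler_wpM2l h)/le_trans; apply.
  have : 0 <= v * `|y| * i ^+ 3 by rewrite !mulr_ge0 ?exprn_ge0// ltW.
  lra.
have b0 : 0 <= (v * (1 + v)) ^+ 2 * i ^+ 3 by rewrite mulr_ge0 ?sqr_ge0// exprn_ge0// ltW.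
have := ler_normD (E1 + E2 + E3) E4; have := ler_normD (E1 + E2) E3.
have := ler_normD E1 E2; lra.
Qed.

End GaussStep.

(** Telescoping: [1 / (n + 2)^2 <= 1 / (n + 1) - 1 / (n + 2)]. *)
Lemma sum_inv_sqr_le2 (R : realType) (n : nat) :
  \sum_(i < n) (i.+1%:R ^+ 2)^-1 <= 2 :> R.
Proof.
case: n => [|n]; first by rewrite big_ord0.
suff : \sum_(i < n.+1) (i.+1%:R ^+ 2)^-1 <= 2 - n.+1%:R^-1 :> R.
  by move=> /le_trans; apply; rewrite lerBlDr lerDl invr_ge0.
elim: n => [|n IH]; first by rewrite big_ord1 expr1n invr1; lra.
rewrite big_ord_recr/= (le_trans (lerD IH (lexx _)))//.
have a0 : 0 < n.+1%:R :> R by rewrite ltr0n.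
have b0 : 0 < n.+2%:R :> R by rewrite ltr0n.
have ab : n.+2%:R = n.+1%:R + 1 :> R by rewrite -natr1.
have h : n.+1%:R^-1 - n.+2%:R^-1 = (n.+1%:R * n.+2%:R)^-1 :> R.
  have ua : n.+1%:R^-1 * n.+1%:R = 1 :> R by rewrite mulVf ?gt_eqF.
  have vb : n.+2%:R^-1 * n.+2%:R = 1 :> R by rewrite mulVf ?gt_eqF.
  rewrite invfM; move: ua vb; rewrite {}ab.
  move: n.+1%:R^-1 => u; move: (n.+1%:R + 1)^-1 => v ua vb.
  have -> : u - v = u * (v * (n.+1%:R + 1)) - v * (u * n.+1%:R).
    by rewrite ua vb !mulr1.
  lra.
have : (n.+2%:R ^+ 2)^-1 <= (n.+1%:R * n.+2%:R)^-1 :> R.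
  rewrite lef_pV2 ?posrE ?exprn_gt0 ?mulr_gt0// expr2 ler_pM2r// ler_nat; lia.
rewrite -h; move: (n.+2%:R ^- 2) n.+1%:R^-1 n.+2%:R^-1 => x y z; lra.
Qed.

(** Bernoulli gives [(1 - eps)^j (1 + j eps) <= (1 - eps^2)^j <= 1]. This turns geometric decay over
    [j] blocks into decay of order [1 / j]. *)
Lemma expr_onem_le (R : realType) (eps : R) j : 0 < eps < 1 ->
  (1 - eps) ^+ j * j.+1%:R <= eps^-1.
Proof.
move=> /andP[e0 e1].
have o0 : 0 <= 1 - eps by lra.
have E0 : 0 <= (1 - eps) ^+ j by rewrite exprn_ge0.
have bern : (1 - eps) ^+ j * (1 + j%:R * eps) <= 1.
  have : 1 + j%:R * eps <= (1 + eps) ^+ j.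
    elim: (j) => [|m IH]; first by rewrite mul0r addr0 expr0.
    have := ler_wpM2r (addr_ge0 ler01 (ltW e0)) IH.
    have : 0 <= m%:R * eps * eps by rewrite !mulr_ge0// ltW.
    rewrite exprSr -natr1; lra.
  move=> /(ler_wpM2l E0)/le_trans; apply.
  rewrite -exprMn exprn_ile1//; last by have := sqr_ge0 eps; lra.
  by rewrite mulr_ge0// addr_ge0// ltW.
rewrite -[leRHS]mul1r ler_pdivlMr//.
have : 0 <= (1 - eps) ^+ j * (1 - eps) by rewrite mulr_ge0.
rewrite -natr1; lra.
Qed.

(** * Expectations and renewal equations *)

Lemma sum_triangle (R : realType) (n : nat) (a : nat -> nat -> R) :
  \sum_(i < n) \sum_(k < n - i) a i k = \sum_(k < n) \sum_(i < n - k) a i k.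
Proof.
have E (b : nat -> nat -> R) : \sum_(i < n) \sum_(k < n - i) b i k =
    \sum_(i < n) \sum_(k < n | (i + k < n)%N) b i k.
  apply: eq_bigr => i _.
  rewrite (big_ord_widen_cond _ xpredT (b i) (leq_subr i n)).
  by apply: eq_bigl => k; rewrite ltn_subRL.
rewrite E [RHS](E (fun k i => a i k)) (exchange_big_dep xpredT)//=.
by apply: eq_bigr => k _; apply: eq_bigl => i; rewrite addnC.
Qed.

(** * Expectations under a law on the integers with all moments *)

Section Law.
Variables (R : realType) (p : nat -> R).
Hypothesis p_ge0 : forall k, 0 <= p k.
Hypothesis p0 : p 0 = 0.
Hypothesis p_sum : series p @ \oo --> (1 : R).
Hypothesis p_mom : forall D, exists M, forall n,
  \sum_(0 <= k < n) p k * k.+1%:R ^+ D <= M.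
Implicit Types f g : nat -> R.

(** A class closed under sums and products on which [p_mom] makes [expect] converge absolutely;
    [k.+1] keeps the bounding power positive at 0. *)
Definition poly_growth f := exists C D, forall k, `|f k| <= C * k.+1%:R ^+ D.

Lemma poly_growth_bnd f (C : R) : (forall k, `|f k| <= C) -> poly_growth f.
Proof. by move=> h; exists C, 0%N => k; rewrite expr0 mulr1. Qed.

Lemma poly_growth_cst (c : R) : poly_growth (fun=> c).
Proof. by apply: (@poly_growth_bnd _ `|c|) => k. Qed.

Lemma poly_growthX D : poly_growth (fun k => k.+1%:R ^+ D).
Proof. by exists 1, D => k; rewrite mul1r ger0_norm. Qed.

Lemma poly_growth_le f g : (forall k, `|f k| <= g k) -> poly_growth g ->
  poly_growth f.
Proof.
move=> fg [C [D h]]; exists C, D => k.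
by rewrite (le_trans (fg k))// (le_trans (ler_norm _)).
Qed.

Lemma poly_growthZ (c : R) f : poly_growth f -> poly_growth (fun k => c * f k).
Proof.
move=> [C [D h]]; exists (`|c| * C), D => k.
by rewrite normrM -mulrA ler_wpM2l.
Qed.

Lemma poly_growthD f g : poly_growth f -> poly_growth g ->
  poly_growth (fun k => f k + g k).
Proof.
move=> [C [D h]] [C' [D' h']]; exists (`|C| + `|C'|), (D + D')%N => k.
have k1 : 1 <= k.+1%:R :> R by rewrite ler1n.
rewrite (le_trans (ler_normD _ _))// mulrDl lerD//.
  rewrite (le_trans (h k))// (le_trans (ler_norm _))// normrM ler_wpM2l//.
  by rewrite ger0_norm ?exprn_ge0// ler_weXn2l// leq_addr.
rewrite (le_trans (h' k))// (le_trans (ler_norm _))// normrM ler_wpM2l//.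
by rewrite ger0_norm ?exprn_ge0// ler_weXn2l// leq_addl.
Qed.

Lemma poly_growthM f g : poly_growth f -> poly_growth g ->
  poly_growth (fun k => f k * g k).
Proof.
move=> [C [D h]] [C' [D' h']]; exists (C * C'), (D + D')%N => k.
by rewrite normrM exprD mulrACA ler_pM.
Qed.

(** [limn] is meaningful only for a convergent series, hence the growth hypotheses in the lemmas
    below. *)
Definition expect f : R := limn (series (fun k => p k * f k)).
Local Notation Ex := expect.

Lemma cvg_expect f : poly_growth f -> series (fun k => p k * f k) @ \oo --> Ex f.
Proof.
move=> [C [D h]].
have [M pM] := p_mom D.
have C0 : 0 <= C by have := le_trans (normr_ge0 _) (h 0%N); rewrite expr1n mulr1.
apply: normed_cvg; apply: nondecreasing_is_cvgn.
  by apply: nondecreasing_series => k _ /=.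
exists (C * M) => _ [n _ <-]; rewrite /series/=.
apply: le_trans (ler_wpM2l C0 (pM n)); rewrite mulr_sumr ler_sum// => k _.
by rewrite normrM (ger0_norm (p_ge0 k)) mulrCA ler_wpM2l.
Qed.

Lemma expect_eq f g : (forall k, (0 < k)%N -> f k = g k) -> Ex f = Ex g.
Proof.
move=> fg; rewrite /Ex; congr (limn (series _)); apply/funext => -[|k].
  by rewrite p0 !mul0r.
by rewrite fg.
Qed.

Lemma expectD f g : poly_growth f -> poly_growth g ->
  Ex (fun k => f k + g k) = Ex f + Ex g.
Proof.
move=> /cvg_expect cf /cvg_expect cg; apply/cvg_lim => //.
have -> : series (fun k => p k * (f k + g k)) =
    (fun n => series (fun k => p k * f k) n + series (fun k => p k * g k) n).
  apply/funext => n; rewrite /series/= -big_split/=.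
  by apply: eq_bigr => k _; rewrite mulrDr.
exact: cvgD.
Qed.

Lemma expectZ (c : R) f : poly_growth f -> Ex (fun k => c * f k) = c * Ex f.
Proof.
move=> /cvg_expect cf; apply/cvg_lim => //.
have -> : series (fun k => p k * (c * f k)) =
    (fun n => c * series (fun k => p k * f k) n).
  apply/funext => n; rewrite /series/= mulr_sumr.
  by apply: eq_bigr => k _; rewrite mulrCA.
by apply: cvgM => //; exact: cvg_cst.
Qed.

Lemma expectB f g : poly_growth f -> poly_growth g ->
  Ex (fun k => f k - g k) = Ex f - Ex g.
Proof.
move=> hf hg; rewrite -mulN1r -expectZ// -expectD//; last exact: poly_growthZ.
by apply: expect_eq => k _; rewrite mulN1r.
Qed.

Lemma expect_cst (c : R) : Ex (fun=> c) = c.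
Proof.
rewrite -[RHS]mulr1; apply/cvg_lim => //.
have -> : series (fun k => p k * c) = (fun n => c * series p n).
  by apply/funext => n; rewrite /series/= -mulr_suml mulrC.
by apply: cvgM => //; exact: cvg_cst.
Qed.

Lemma expect_le f g : poly_growth f -> poly_growth g ->
  (forall k, (0 < k)%N -> f k <= g k) -> Ex f <= Ex g.
Proof.
move=> /cvg_expect cf /cvg_expect cg fg; apply: (ler_cvg_to cf cg).
apply: nearW => n; rewrite /series/= ler_sum// => -[|k] _.
  by rewrite p0 !mul0r.
by rewrite ler_wpM2l// fg.
Qed.

Lemma expect_ge0 f : poly_growth f -> (forall k, (0 < k)%N -> 0 <= f k) -> 0 <= Ex f.
Proof.
move=> hf f0; rewrite -(expect_cst 0); apply: expect_le => //.
exact: poly_growth_cst.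
Qed.

Lemma expect_norm_le f g : poly_growth f -> poly_growth g ->
  (forall k, (0 < k)%N -> `|f k| <= g k) -> `|Ex f| <= Ex g.
Proof.
move=> hf hg fg; rewrite ler_norml; apply/andP; split.
  rewrite -mulN1r -expectZ//; apply: expect_le => //; first exact: poly_growthZ.
  by move=> k k0; rewrite mulN1r; have := fg _ k0; rewrite ler_norml => /andP[].
by apply: expect_le => // k k0; have := fg _ k0; rewrite ler_norml => /andP[].
Qed.

Lemma expect_fin f n : (forall k, (n <= k)%N -> f k = 0) ->
  Ex f = \sum_(k < n) p k * f k.
Proof.
move=> f0; apply/cvg_lim => //; apply: cvg_near_cst; near=> N.
have nN : (n <= N)%N by near: N; exact: nbhs_infty_ge.
rewrite /series/= (big_cat_nat _ nN)//= big_mkord [X in _ + X]big1_seq ?addr0//.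
by move=> k; rewrite mem_index_iota => /andP[_ /andP[nk _]]; rewrite f0// mulr0.
Unshelve. all: by end_near. Qed.

(** * Tails and truncated moments of the law *)

Definition tail i : R := Ex (fun k => (i < k)%:R).
Local Notation q := tail.

Lemma poly_growth_ind (P : pred nat) : poly_growth (fun k => (P k)%:R).
Proof. by apply: (@poly_growth_bnd _ 1) => k; case: (P k); rewrite ?normr0 ?normr1. Qed.

Lemma poly_growth_nat (g : nat -> nat) : (forall k, (g k <= k)%N) ->
  poly_growth (fun k => (g k)%:R).
Proof.
move=> gk; apply: poly_growth_le (poly_growthX 1) => k.
by rewrite expr1 ger0_norm// ler_nat leqW.
Qed.

Lemma tail_ge0 i : 0 <= q i.
Proof. by apply: expect_ge0 => //; exact: poly_growth_ind. Qed.

Lemma tail0 : q 0 = 1.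
Proof. by rewrite -(expect_cst 1); apply: expect_eq => k ->. Qed.

Lemma tailS a : q a = p a.+1 + q a.+1.
Proof.
have -> : p a.+1 = Ex (fun k => (k == a.+1)%:R).
  rewrite (@expect_fin _ a.+2); last first.
    by move=> k ak; rewrite gtn_eqF.
  rewrite big_ord_recr/= eqxx mulr1 big1 ?add0r// => k _.
  by rewrite ltn_eqF// mulr0.
rewrite -expectD; [|exact: poly_growth_ind..].
apply: expect_eq => k _; rewrite (ltn_neqAle a.+1) eq_sym.
by have [->|] := eqVneq k a.+1; rewrite ?ltnSn ?addr0 ?add0r.
Qed.

(** Conditioning on whether the first step fits into [n]; an overshoot contributes the boundary term
    [q n * c]. *)
Lemma tail_split n f (c : R) : Ex (fun k => if (k <= n)%N then f k else c) =
  \sum_(k < n.+1) p k * f k + q n * c.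
Proof.
have -> : \sum_(k < n.+1) p k * f k = Ex (fun k => if (k <= n)%N then f k else 0).
  rewrite (@expect_fin _ n.+1) => [|k]; last by rewrite ltnNge => /negPf ->.
  by apply: eq_bigr => k _; rewrite -ltnS ltn_ord.
rewrite mulrC -expectZ; last exact: poly_growth_ind.
rewrite -expectD; last 2 first.
- pose C := \sum_(k < n.+1) `|f k|.
  apply: (@poly_growth_bnd _ C) => k; case: ifPn => kn; last first.
    by rewrite normr0 sumr_ge0.
  rewrite /C (bigD1 (Ordinal (kn : (k < n.+1)%N)))//= lerDl.
  by rewrite sumr_ge0.
- exact/poly_growthZ/poly_growth_ind.
apply: expect_eq => k _; rewrite ltnNge.
by case: (k <= n)%N; rewrite ?mulr0 ?addr0 ?mulr1 ?add0r.
Qed.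

(** Markov's inequality for the moment of order [D]. *)
Lemma tail_le D i : q i <= Ex (fun k => k.+1%:R ^+ D) / i.+1%:R ^+ D.
Proof.
rewrite mulrC -expectZ; last exact: poly_growthX.
apply: expect_le => [||k _].
- exact: poly_growth_ind.
- exact/poly_growthZ/poly_growthX.
have i0 : 0 < i.+1%:R ^+ D :> R by rewrite exprn_gt0.
rewrite mulrC ler_pdivlMr//; case: (ltnP i k) => ik; rewrite ?mul0r ?mul1r//.
by rewrite lerXn2r ?nnegrE// ler_nat ltnS ltnW.
Qed.

(** The identity E[X] = sum_i P(X > i), truncated at [n]. *)
Lemma sum_tail n : \sum_(i < n) q i = Ex (fun k => (minn k n)%:R).
Proof.
elim: n => [|n IH].
  rewrite big_ord0 -[LHS](expect_cst 0); apply: expect_eq => k _.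
  by rewrite minn0.
rewrite big_ord_recr/= IH -expectD; last 2 first.
- by apply: poly_growth_nat => k; exact: geq_minl.
- exact: poly_growth_ind.
apply: expect_eq => k _; rewrite -natrD; congr (_%:R).
by case: ltnP => h; rewrite /=; lia.
Qed.

Lemma sum_p_le1 n : \sum_(k < n) p k.+1 <= 1.
Proof.
have -> : \sum_(k < n) p k.+1 = \sum_(k < n.+1) p k * 1.
  by rewrite big_ord_recl/= p0 mul0r add0r; apply: eq_bigr => k _; rewrite mulr1.
have := tail_split n (fun=> 1) 0; rewrite mulr0 addr0 => <-.
rewrite -{2}(expect_cst 1); apply: expect_le => [||k _].
- by apply: (@poly_growth_bnd _ 1) => k; case: ifP; rewrite ?normr0 ?normr1.
- exact: poly_growth_cst.
- by case: ifP.
Qed.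

Lemma expect_ge_term f k : poly_growth f ->
  (forall j, (0 < j)%N -> 0 <= f j) -> p k * f k <= Ex f.
Proof.
move=> gf f0.
have gi : poly_growth (fun j => (j == k)%:R * f j).
  by apply: poly_growthM => //; exact: poly_growth_ind.
have <- : Ex (fun j => (j == k)%:R * f j) = p k * f k.
  rewrite (@expect_fin _ k.+1); last by move=> j kj; rewrite gtn_eqF// mul0r.
  rewrite big_ord_recr/= eqxx mul1r big1 ?add0r// => j _.
  by rewrite ltn_eqF// mul0r mulr0.
by apply: expect_le => // j j0; case: eqP => _; rewrite ?mul1r ?mul0r ?f0.
Qed.

Lemma sum_p_tail n : \sum_(k < n) p k.+1 + q n = 1.
Proof.
elim: n => [|n IH]; first by rewrite big_ord0 add0r tail0.
by rewrite big_ord_recr/= -addrA -tailS.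
Qed.

(** * Doeblin contraction and approximate renewal equations *)

Section Renewal.
Variables (N : nat) (eps : R).
Hypothesis N_gt0 : (0 < N)%N.
Hypothesis eps01 : 0 < eps < 1.
(* Whatever its age [a], the current step ends exactly [N] time units later with
   probability at least [eps]. *)
Hypothesis doeblin : forall a, eps * q a <= p (a + N)%N.
Hypothesis tail_gt0 : forall a, 0 < q a.

(** Here [n] is the time left and [a] the age of the current step. In one unit of time the step ends
    with conditional weight [p a.+1 / q a], resetting the age to 0, or else the age grows. The first
    claim propagates a lower bound; the second also keeps the gain [x n 0 - lo] on the event that
    the step lasts exactly [j + 1] more units. *)
Lemma age_lower (x : nat -> nat -> R) (eta lo : R) n : 0 <= eta ->
  (forall n a, p a.+1 * x n 0%N + q a.+1 * x n a.+1 - q a * eta <= q a * x n.+1 a) ->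
  (forall a, lo <= x n a) ->
  (forall j a, lo - j%:R * eta <= x (n + j)%N a) /\
  (forall j a, q a * (lo - j.+1%:R * eta) + p (a + j.+1)%N * (x n 0%N - lo)
     <= q a * x (n + j.+1)%N a).
Proof.
move=> eta0 xr xlo.
have low j : forall a, lo - j%:R * eta <= x (n + j)%N a.
  elim: j => [|j IH] a; first by rewrite addn0 mul0r subr0.
  rewrite -(ler_pM2l (tail_gt0 a)) addnS (le_trans _ (xr _ _))//.
  have := ler_wpM2l (p_ge0 a.+1) (IH 0%N).
  have := ler_wpM2l (tail_ge0 a.+1) (IH a.+1).
  rewrite -natr1 [q a]tailS; lra.
split=> // j; elim: j => [|j IH] a.
  rewrite addn1 addn1 (le_trans _ (xr _ _))//.
  have := ler_wpM2l (tail_ge0 a.+1) (xlo a.+1).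
  rewrite [q a]tailS; lra.
rewrite (addnS n) (le_trans _ (xr _ _))//.
have := ler_wpM2l (p_ge0 a.+1) (low j.+1 0%N).
have := IH a.+1; rewrite addSnnS.
rewrite -(natr1 j.+1) [q a]tailS; lra.
Qed.

(** [age_lower] is applied to [x] and to [- x]. By the Doeblin condition all ages share, with weight
    [eps], the value [x n 0] after [N] units, so the oscillation shrinks by the factor [1 - eps]. *)
Lemma age_contract (x : nat -> nat -> R) (eta lo c : R) n : 0 <= eta ->
  (forall n a, `|q a * x n.+1 a - (p a.+1 * x n 0%N + q a.+1 * x n a.+1)| <= q a * eta) ->
  (forall a, lo <= x n a <= lo + c) ->
  (forall j, lo - j%:R * eta <= x (n + j)%N 0%N <= lo + c + j%:R * eta) /\
  exists lo', forall a, lo' <= x (n + N)%N a <= lo' + ((1 - eps) * c + 2 * N%:R * eta).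
Proof.
move=> eta0 xr xlo; have /andP[e0 e1] := eps01.
have [||l1 l2] := @age_lower x eta lo n eta0 _ _.
- by move=> m a; have := xr m a; rewrite ler_norml => /andP[]; lra.
- by move=> a; have /andP[] := xlo a.
have [||h1 h2] := @age_lower (fun n a => - x n a) eta (- (lo + c)) n eta0 _ _.
- by move=> m a; have := xr m a; rewrite ler_norml => /andP[]; lra.
- by move=> a; have /andP[] := xlo a; lra.
split.
  by move=> j; rewrite l1/=; have := h1 j 0%N; lra.
(* The old bound, lowered by the [N] accumulated defects and raised by the share [eps] of the common
   value. *)
exists (lo - N%:R * eta + eps * (x n 0%N - lo)) => a.
have /andP[x0 x0'] := xlo 0%N.
have := l2 N.-1 a; have := h2 N.-1 a; rewrite prednK// => ha la.
have d1 : 0 <= (p (a + N)%N - eps * q a) * (x n 0%N - lo).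
  by rewrite mulr_ge0// subr_ge0.
have d2 : 0 <= (p (a + N)%N - eps * q a) * (lo + c - x n 0%N).
  by rewrite mulr_ge0// subr_ge0.
apply/andP; split; rewrite -(ler_pM2l (tail_gt0 a)); lra.
Qed.

(** Iterating the contraction over blocks of length [N]; [2 N eta / eps] is the fixed point of
    [c |-> (1 - eps) c + 2 N eta]. *)
Lemma renewal_osc (f : nat -> R) (eta : R) : 0 <= eta ->
  (forall n, 0 <= f n <= 1) ->
  (forall n, `|f n.+1 - \sum_(k < n.+1) p k.+1 * f (n - k)%N| <= eta) ->
  forall j, exists lo, forall i, lo - i%:R * eta <= f (j * N + i)%N <=
    lo + ((1 - eps) ^+ j + 2 * N%:R * eta / eps) + i%:R * eta.
Proof.
move=> eta0 f01 fr j; have /andP[e0 e1] := eps01.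
(* [x n a] is the analogue of [f n] for a process whose current step has already
   lasted [a] time units. *)
pose x n a := if a == 0%N then f n
  else (\sum_(k < n) p (a + k.+1)%N * f (n - k.+1)%N) / q a.
have xr n a : `|q a * x n.+1 a - (p a.+1 * x n 0%N + q a.+1 * x n a.+1)| <= q a * eta.
  have -> : p a.+1 * x n 0%N + q a.+1 * x n a.+1 =
      \sum_(k < n.+1) p (a + k.+1)%N * f (n - k)%N.
    rewrite /x/= [q _ * _]mulrC divfK ?gt_eqF// big_ord_recl/= addn1 subn0; congr (_ + _).
    by apply: eq_bigr => k _; rewrite addSnnS.
  rewrite /x; case: a => [|a]/=; first by rewrite tail0 !mul1r; exact: fr.
  rewrite mulrC divfK ?gt_eqF// subrr normr0 mulr_ge0//; exact: tail_ge0.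
suff [lo hlo] : exists lo, forall a, lo <= x (j * N)%N a <=
    lo + ((1 - eps) ^+ j + 2 * N%:R * eta / eps).
  have [h _] := age_contract eta0 xr hlo.
  by exists lo => i; have := h i.
elim: j => [|j [lo hlo]].
  (* With no time left, [x 0 a] is [f 0] or an empty sum, so [[0, 1]] contains all these values. *)
  exists 0 => a; rewrite /x mul0n big_ord0 mul0r expr0 add0r.
  have h : 0 <= 2 * N%:R * eta / eps by rewrite divr_ge0 ?mulr_ge0// ltW.
  by case: eqP => _; have := f01 0%N; lra.
have [_ [lo' hlo']] := age_contract eta0 xr hlo.
exists lo' => a; rewrite mulSn addnC; have := hlo' a.
have : eps^-1 * eps = 1 by rewrite mulVf// gt_eqF.
rewrite exprS; move: eps^-1 ((1 - eps) ^+ j) => ie E ie1.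
have -> : (1 - eps) * (E + 2 * N%:R * eta * ie) + 2 * N%:R * eta =
  (1 - eps) * E + 2 * N%:R * eta * ie + 2 * N%:R * eta * (1 - ie * eps) by lra.
by rewrite ie1 subrr mulr0 addr0.
Qed.

(** The difference splits into [f n] times the part of E[X] missing from the finite sum of tails,
    and a sum of the increments [f n - f (n - i)] weighted by [q i]. Oscillation decay bounds these
    increments by a multiple of [(i + 1) (eta + 1 / (n + 1))]. *)
Lemma renewal_average : exists C, 0 <= C /\ forall (f : nat -> R) (eta : R), 0 <= eta ->
  (forall n, 0 <= f n <= 1) ->
  (forall n, `|f n.+1 - \sum_(k < n.+1) p k.+1 * f (n - k)%N| <= eta) ->
  forall n, `|Ex (fun k => k%:R) * f n - \sum_(i < n.+1) q i * f (n - i)%N|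
    <= C * (eta + n.+1%:R^-1).
Proof.
have /andP[e0 e1] := eps01.
pose C1 := 3 * N%:R / eps + 2 * N%:R + 1.
pose M2 := Ex (fun k => k.+1%:R ^+ 2); pose M3 := Ex (fun k => k.+1%:R ^+ 3).
have M20 : 0 <= M2 by apply: expect_ge0 => //; exact: poly_growthX.
have M30 : 0 <= M3 by apply: expect_ge0 => //; exact: poly_growthX.
have ie0 : 0 < eps^-1 by rewrite invr_gt0.
have ie1 : 1 < eps^-1 by rewrite invf_gt1.
have N0 : 0 <= N%:R :> R by [].
have NE : N%:R <= N%:R / eps by rewrite ler_peMr// ltW.
have C10 : 0 <= C1 by rewrite /C1; lra.
exists (M2 + 2 * C1 * M3); split; first by rewrite addr_ge0 ?mulr_ge0.
move=> f eta eta0 f01 fr n.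
(* Both [n - i] and [n] are reached from the end of block [j = (n - i) %/ N], after at most [N] and
   [N + i] further units. *)
have osc i : (i <= n)%N -> `|f n - f (n - i)%N| <= C1 * i.+1%:R * (eta + n.+1%:R^-1).
  move=> le_in.
  have [lo hlo] := renewal_osc eta0 f01 fr ((n - i) %/ N)%N.
  set j := ((n - i) %/ N)%N in hlo.
  have jN : ((n - i) = j * N + (n - i) %% N)%N by exact: divn_eq.
  have nj : (n = j * N + ((n - i) %% N + i))%N by rewrite addnA -jN subnK.
  have rN : ((n - i) %% N < N)%N by rewrite ltn_mod.
  have := hlo ((n - i) %% N)%N; have := hlo ((n - i) %% N + i)%N.
  rewrite -jN -nj.
  set c := _ ^+ j + _.
  have r1 : ((n - i) %% N)%:R <= N%:R :> R by rewrite ler_nat ltnW.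
  have r2 : ((n - i) %% N + i)%:R <= N%:R + i%:R :> R by rewrite -natrD ler_nat leq_add2r ltnW.
  have := ler_wpM2r eta0 r1; have := ler_wpM2r eta0 r2.
  move=> ? ? /andP[? ?] /andP[? ?].
  have d : `|f n - f (n - i)%N| <= c + (2 * N%:R + i%:R) * eta by rewrite ler_norml; lra.
  (* Since [n - i < (j + 1) N], one has [n + 1 <= (j + 1) N (i + 1)], and [expr_onem_le] converts
     the power into a multiple of [(i + 1) / (n + 1)]. *)
  have ej : (1 - eps) ^+ j <= N%:R / eps * (i.+1%:R / n.+1%:R).
    have E0 : 0 <= (1 - eps) ^+ j by rewrite exprn_ge0// subr_ge0 ltW.
    have b2 := expr_onem_le j eps01.
    rewrite mulrA ler_pdivlMr ?ltr0n//.
    have cnt : n.+1%:R <= j.+1%:R * N%:R * i.+1%:R :> R.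
      rewrite -!natrM ler_nat.
      have : (n - i < j.+1 * N)%N by rewrite mulSn [in ltnLHS]jN addnC ltn_add2r.
      move: (j.+1 * N)%N => A hA; rewrite mulnS.
      have : (i <= A * i)%N by rewrite leq_pmull// (leq_trans _ hA).
      by move: hA; clear; lia.
    apply: (le_trans (ler_wpM2l E0 cnt)).
    by rewrite !mulrA ler_wpM2r// [leLHS]mulrC ler_wpM2l.
  rewrite (le_trans d)// /c.
  have i1 : 1 <= i.+1%:R :> R by rewrite ler1n.
  have ii : i%:R <= i.+1%:R :> R by rewrite ler_nat.
  have inv0 : 0 < n.+1%:R^-1 :> R by rewrite invr_gt0.
  have NE0 : 0 <= N%:R / eps by lra.
  have s1 : N%:R / eps * (i.+1%:R / n.+1%:R) <= C1 * i.+1%:R * n.+1%:R^-1.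
    by rewrite mulrA ler_wpM2r ?(ltW inv0)// ler_wpM2r// /C1; lra.
  have s2 : 2 * N%:R / eps + 2 * N%:R + i%:R <= C1 * i.+1%:R.
    have h : 0 <= (C1 - 1) * (i.+1%:R - 1).
      by rewrite mulr_ge0 ?subr_ge0// /C1; lra.
    move: h; rewrite -natr1 /C1; lra.
  have := le_trans ej s1; have := ler_wpM2r eta0 s2.
  move: eps^-1 ((1 - eps) ^+ j) (C1 * i.+1%:R) n.+1%:R^-1 => ie E Z v; lra.
have -> : Ex (fun k => k%:R) * f n - \sum_(i < n.+1) q i * f (n - i)%N =
    (Ex (fun k => k%:R) - \sum_(i < n.+1) q i) * f n +
    \sum_(i < n.+1) q i * (f n - f (n - i)%N).
  rewrite mulrBl mulr_suml.
  have -> : \sum_(i < n.+1) q i * (f n - f (n - i)%N) =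
    \sum_(i < n.+1) q i * f n - \sum_(i < n.+1) q i * f (n - i)%N.
    by rewrite -sumrB; apply: eq_bigr => i _; rewrite mulrBr.
  lra.
have inv0 : 0 <= n.+1%:R^-1 :> R by rewrite invr_ge0.
(* The missing tails add up to the expectation of [k - minn k n.+1], which is nonzero only for
   [k > n + 1] and then at most [(k + 1)^2 / (n + 1)]. *)
have b1 : `|(Ex (fun k => k%:R) - \sum_(i < n.+1) q i) * f n| <= M2 * n.+1%:R^-1.
  rewrite normrM -[leRHS]mulr1; apply: ler_pM => //; last first.
    by have /andP[? ?] := f01 n; rewrite ger0_norm.
  rewrite sum_tail -expectB; last 2 first.
  - exact: poly_growth_nat.
  - by apply: poly_growth_nat => k; exact: geq_minl.
  rewrite mulrC -expectZ; last exact: poly_growthX.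
  apply: expect_norm_le => [||k _].
  - rewrite (_ : (fun k => _) = fun k => (k - minn k n.+1)%:R :> R).
      by apply: poly_growth_nat => k; exact: leq_subr.
    by apply/funext => k; rewrite natrB// geq_minl.
  - exact/poly_growthZ/poly_growthX.
  - rewrite -natrB ?geq_minl// ger0_norm// mulrC ler_pdivlMr ?ltr0n//.
    rewrite -natrM -natrX ler_nat; case: (leqP k n.+1) => kn.
      by rewrite subnn mul0n.
    nia.
(* The third moment gives [q i * (i + 1) <= M3 / (i + 1)^2], which is summable. *)
have b2 : `|\sum_(i < n.+1) q i * (f n - f (n - i)%N)| <=
    2 * C1 * M3 * (eta + n.+1%:R^-1).
  have en0 : 0 <= eta + n.+1%:R^-1 by rewrite addr_ge0.
  have K0 : 0 <= M3 * C1 * (eta + n.+1%:R^-1) by rewrite !mulr_ge0.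
  have := ler_wpM2l K0 (sum_inv_sqr_le2 R n.+1).
  rewrite [X in _ <= X -> _](_ : _ = 2 * C1 * M3 * (eta + n.+1%:R^-1)); last first.
    by move: n.+1%:R^-1 => v; lra.
  apply: le_trans; rewrite mulr_sumr; apply: (le_trans (ler_norm_sum _ _ _)).
  apply: ler_sum => i _; rewrite normrM (ger0_norm (tail_ge0 _)).
  apply: (le_trans (ler_pM (tail_ge0 _) (normr_ge0 _) (tail_le 3 i) (osc i _))).
    by rewrite -ltnS.
  rewrite -/M3.
  have -> : M3 / i.+1%:R ^+ 3 * (C1 * i.+1%:R * (eta + n.+1%:R^-1)) =
     M3 * C1 * (eta + n.+1%:R^-1) * (i.+1%:R / i.+1%:R ^+ 3).
    by move: (i.+1%:R : R) (n.+1%:R^-1) (i.+1%:R ^+ 3)^-1 => w v u; lra.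
  rewrite ler_wpM2l// [X in _ / X]exprS invfM mulrA divff ?mul1r//.
apply: (le_trans (ler_normD _ _)).
have : 0 <= M2 * eta by rewrite mulr_ge0.
move: n.+1%:R^-1 inv0 b1 b2 => v v0; lra.
Qed.

(** Averaging against [q] preserves the renewal equation, by exchanging the sums over the triangle;
    the term [i = n + 1] stays as a boundary value. *)
Lemma average_rec (Y : nat -> R) (F : nat -> R -> R) n w :
  (forall n w, F n.+1 w = \sum_(k < n.+1) p k.+1 * F (n - k)%N (w - Y k.+1)) ->
  \sum_(i < n.+2) q i * F (n.+1 - i)%N w =
  \sum_(k < n.+1) p k.+1 * (\sum_(i < (n - k).+1) q i * F (n - k - i)%N (w - Y k.+1))
  + q n.+1 * F 0%N w.
Proof.
move=> FS; rewrite big_ord_recr/= subnn; congr (_ + _).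
pose a i k := q i * (p k.+1 * F (n - i - k)%N (w - Y k.+1)).
transitivity (\sum_(i < n.+1) \sum_(k < n.+1 - i) a i k).
  apply: eq_bigr => i _; have le_in : (i <= n)%N by rewrite -ltnS.
  by rewrite subSn// FS mulr_sumr.
rewrite sum_triangle; apply: eq_bigr => k _.
have kn : (k <= n)%N by rewrite -ltnS.
rewrite subSn// mulr_sumr; apply: eq_bigr => i _.
by rewrite /a mulrCA subnAC.
Qed.

(** The average of [u] against [q] is exactly 1, by [average_rec] and [sum_p_tail], so
    [renewal_average] applies with [eta = 0]. *)
Lemma renewal_density : exists C, 0 <= C /\ forall u : nat -> R, u 0%N = 1 ->
  (forall n, u n.+1 = \sum_(k < n.+1) p k.+1 * u (n - k)%N) ->
  forall n, `|Ex (fun k => k%:R) * u n - 1| <= C / n.+1%:R.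
Proof.
have [C [C0 hC]] := renewal_average.
exists C; split=> // u u0 uS n.
have u01 m : 0 <= u m <= 1.
  elim/ltn_ind: m => -[_|m IH]; first by rewrite u0 ler01 lexx.
  rewrite uS; apply/andP; split.
    apply: sumr_ge0 => k _; rewrite mulr_ge0//.
    by have /andP[] := IH (m - k)%N (leq_subr _ _).
  apply: le_trans (sum_p_le1 m.+1); apply: ler_sum => k _; rewrite ler_piMr//.
  by have /andP[] := IH (m - k)%N (leq_subr _ _).
have A1 m : \sum_(i < m.+1) q i * u (m - i)%N = 1.
  elim/ltn_ind: m => -[_|m IH]; first by rewrite big_ord1 tail0 u0 mulr1.
  rewrite (@average_rec (fun=> 0) (fun n _ => u n) m 0)// u0 mulr1.
  rewrite -(sum_p_tail m.+1); congr (_ + _); apply: eq_bigr => k _.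
  by rewrite IH ?mulr1// ltnS leq_subr.
have := hC u 0 (lexx _) u01 _ n; rewrite A1 add0r; apply => m.
by rewrite uS subrr normr0.
Qed.

(** * Comparison of the smoothed distribution with a Gaussian profile *)

Variables (Y : nat -> R) (CY sg : R).
Hypothesis CY_ge0 : 0 <= CY.
Hypothesis Y_le : forall k, `|Y k| <= CY * k.+1%:R.
Hypothesis sg_gt0 : 0 < sg.
Hypothesis EY : Ex Y = 0.
Hypothesis EY2 : Ex (fun k => Y k ^+ 2) = sg * Ex (fun k => k%:R).

Local Notation Phi := (@std_normal_cdf R).
Local Notation phi := (@std_normal_pdf R).
Local Notation sd s0 n := (Num.sqrt (s0 ^+ 2 + sg * n%:R)).

Lemma sd_sqr (s0 : R) n : sd s0 n ^+ 2 = s0 ^+ 2 + sg * n%:R.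
Proof. by rewrite sqr_sqrtr// addr_ge0 ?sqr_ge0// mulr_ge0// ltW. Qed.

Lemma sd_ge (s0 : R) n : 0 <= s0 -> s0 <= sd s0 n.
Proof.
move=> h; rewrite -(@ler_pXn2r _ 2) ?nnegrE ?sqrtr_ge0//.
by rewrite sd_sqr lerDl mulr_ge0// ltW.
Qed.

Lemma poly_growthY : poly_growth Y.
Proof. by exists CY, 1%N => k; rewrite expr1. Qed.

(** The expansion of one step is affine in [Y k] and [Y k ^+ 2 - sg * k], two quantities whose
    expectations vanish by [EY] and [EY2]. *)
Local Notation gauss_jet z s k := (Phi z - Y k * (phi z / s)
  - (Y k ^+ 2 - sg * k%:R) * (z * phi z / (2 * s ^+ 2))).

(** [std_normal_cdf_step] for variances that differ by [sg * k]; every error term is dominated by a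
    fourth power of [k + 1]. *)
Lemma gauss_step_le (s0 w : R) n k : 1 <= s0 -> (k <= n)%N ->
  `|Phi ((w - Y k) / sd s0 (n - k)%N) - gauss_jet (w / sd s0 n) (sd s0 n) k| <=
  (3 * CY ^+ 3 + 18 * (sg * (1 + sg)) ^+ 2 + 2 * (sg * CY)) * k.+1%:R ^+ 4
    * (sd s0 n ^+ 3)^-1.
Proof.
move=> s01 kn; have s00 : 0 < s0 by rewrite (lt_le_trans ltr01).
have sgg := ltW sg_gt0.
have ssd m : s0 <= sd s0 m by rewrite sd_ge// ltW.
have sd0 m : 0 < sd s0 m := lt_le_trans s00 (ssd m).
have h1 : 1 <= sd s0 (n - k)%N by rewrite (le_trans s01).
have h2 : sd s0 n ^+ 2 = sd s0 (n - k)%N ^+ 2 + sg * k%:R.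
  by rewrite !sd_sqr natrB// mulrBr addrA subrK.
apply: (le_trans (std_normal_cdf_step w (Y k) sgg (ler0n _ k) h1 (sd0 n) h2)).
rewrite ler_wpM2r ?invr_ge0 ?exprn_ge0 ?(ltW (sd0 n))//.
set K := k.+1%:R; have K1 : 1 <= K by rewrite ler1n.
have kK : k%:R <= K by rewrite ler_nat.
have K0 : 0 <= K by rewrite (le_trans ler01).
have y3 : `|Y k| ^+ 3 <= CY ^+ 3 * K ^+ 4.
  rewrite (le_trans (lerXn2r _ _ _ (Y_le k))) ?nnegrE ?mulr_ge0//.
  by rewrite exprMn ler_wpM2l ?exprn_ge0// ler_weXn2l.
have v1 : sg * k%:R <= sg * K by rewrite ler_wpM2l.
have v2 : (sg * k%:R * (1 + sg * k%:R)) ^+ 2 <= (sg * (1 + sg)) ^+ 2 * K ^+ 4.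
  rewrite (_ : 4 = 2 * 2)%N // exprM -exprMn lerXn2r ?nnegrE//.
  - by rewrite mulr_ge0 ?addr_ge0 ?mulr_ge0.
  - by rewrite !mulr_ge0 ?addr_ge0.
  rewrite expr2 mulrACA ler_pM ?addr_ge0 ?mulr_ge0//.
  rewrite mulrDl mul1r lerD//.
have v3 : sg * k%:R * `|Y k| <= sg * CY * K ^+ 4.
  rewrite (@le_trans _ _ (sg * K * (CY * K)))//.
    by rewrite ler_pM ?mulr_ge0// Y_le.
  rewrite mulrACA ler_wpM2l ?mulr_ge0// -expr2 ler_weXn2l//.
move: (K ^+ 4) y3 v2 v3 => K4; lra.
Qed.

(** For an overshooting step the jet is compared with the boundary value. The difference is of order
    [K^2 / s0] with [K = k + 1], and two further powers of [K > n + 1] buy the summable factor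
    [1 / (n + 1)^2]. *)
Lemma gauss_step_gt (s0 w : R) n k : 1 <= s0 -> (n < k)%N ->
  `|Phi (w / s0) - gauss_jet (w / sd s0 n) (sd s0 n) k| <=
  (2 * sg + CY + CY ^+ 2) * k.+1%:R ^+ 4 * (s0^-1 * (n.+1%:R ^+ 2)^-1).
Proof.
move=> s01 nk; have s00 : 0 < s0 by rewrite (lt_le_trans ltr01).
have sgg := ltW sg_gt0.
have ss : s0 <= sd s0 n by rewrite sd_ge// ltW.
have s2 := sd_sqr s0 n.
move: (sd s0 n) ss s2 => s ss s2.
have s0' : 0 < s := lt_le_trans s00 ss.
set K := k.+1%:R; have K1 : 1 <= K by rewrite ler1n.
have kK : k%:R <= K by rewrite ler_nat.
have nK : n%:R <= K by rewrite ler_nat ltnW// leqW.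
have K0 : 0 <= K by rewrite (le_trans ler01).
pose i := s0^-1; have i0 : 0 < i by rewrite invr_gt0.
have i1 : i <= 1 by rewrite invf_le1.
have si : s^-1 <= i by rewrite lef_pV2 ?posrE.
have si0 : 0 < s^-1 by rewrite invr_gt0.
have KK : K <= K ^+ 2 by rewrite -[leLHS]expr1 ler_weXn2l.
suff bnd : `|Phi (w / s0) - gauss_jet (w / s) s k| <= (2 * sg + CY + CY ^+ 2) * K ^+ 2 * i.
  rewrite (le_trans bnd)//.
  have n0 : 0 < n.+1%:R ^+ 2 :> R by rewrite exprn_gt0.
  rewrite [leRHS]mulrA ler_pdivlMr// mulrAC ler_wpM2r ?(ltW i0)//.
  rewrite -[leLHS]mulrA ler_wpM2l//.
    by rewrite !addr_ge0 ?mulr_ge0 ?exprn_ge0.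
  rewrite [leRHS](exprD K 2 2) ler_wpM2l ?exprn_ge0// lerXn2r ?nnegrE// ler_nat.
  by rewrite ltnW.
set z := w / s; pose c := s / s0.
have c1 : 1 <= c by rewrite ler_pdivlMr// mul1r.
have zc : w / s0 = z * c by rewrite /z /c mulrA divfK// gt_eqF.
have b1 : `|Phi (w / s0) - Phi z| <= sg * K ^+ 2 * i.
  rewrite zc (le_trans (std_normal_cdf_scale_lip z c1))//.
  apply: (@le_trans _ _ (c ^+ 2 - 1)); first by have := sqr_ge0 (c - 1); lra.
  have -> : c ^+ 2 - 1 = sg * n%:R * i ^+ 2.
    rewrite /c exprMn s2 -/i mulrDl -exprMn divff ?gt_eqF// expr1n; lra.
  rewrite -(mulrA sg n%:R) -(mulrA sg (K ^+ 2)) ler_wpM2l//; apply: ler_pM => //.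
  - by rewrite exprn_ge0// ltW.
  - exact: le_trans nK KK.
  - by rewrite expr2 ler_piMl// ltW.
have [p1 p2 _ _] := std_normal_pdf_moments z.
have pp := std_normal_pdf_ge0 z.
have b2 : `|Y k * (phi z / s)| <= CY * K ^+ 2 * i.
  rewrite normrM -mulrA; apply: (@le_trans _ _ (CY * K * i)).
    rewrite ler_pM// ?Y_le// ger0_norm ?divr_ge0 1?(ltW s0')//.
    by rewrite -[leRHS]mul1r ler_pM// ltW.
  by rewrite -mulrA ler_wpM2l// ler_wpM2r// ltW.
have b3 : `|(Y k ^+ 2 - sg * k%:R) * (z * phi z / (2 * s ^+ 2))| <=
    (CY ^+ 2 + sg) * K ^+ 2 * i.
  rewrite normrM; apply: ler_pM => //.
    have := ler_normB (Y k ^+ 2) (sg * k%:R); move=> /le_trans; apply.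
    rewrite mulrDl lerD//.
      rewrite normrX -exprMn lerXn2r ?nnegrE ?mulr_ge0//; exact: Y_le.
    rewrite ger0_norm ?mulr_ge0// ler_wpM2l//; exact: le_trans kK KK.
  rewrite normrM normrM (ger0_norm pp) -[leRHS]mul1r ler_pM// ?mulr_ge0//.
  rewrite ger0_norm ?invr_ge0 ?mulr_ge0 ?exprn_ge0 1?(ltW s0')//.
  rewrite invfM -exprVn; apply: (@le_trans _ _ (s^-1 ^+ 2)).
    by rewrite ler_piMl ?exprn_ge0 ?(ltW si0)//; lra.
  apply: (le_trans _ si); rewrite expr2 ler_piMl ?(ltW si0)//.
  exact: le_trans si i1.
have := ler_normB (Phi (w / s0) - Phi z)
  (- (Y k * (phi z / s)) - (Y k ^+ 2 - sg * k%:R) * (z * phi z / (2 * s ^+ 2))).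
have := ler_normB (- (Y k * (phi z / s)))
  ((Y k ^+ 2 - sg * k%:R) * (z * phi z / (2 * s ^+ 2))).
rewrite normrN.
set A := Phi (w / s0) in b1 *; set Y1 := Y k * _ in b2 *; set Y2 := (_ - _) * (_ / _) in b3 *.
have -> : A - Phi z - (- Y1 - Y2) = A - (Phi z - Y1 - Y2) by lra.
lra.
Qed.

(** The jet averages to [Phi (w / sd s0 n)], so the defect is the expectation of the errors of the
    two preceding lemmas, finite by the fourth moment. *)
Lemma gauss_defect : exists C, 0 <= C /\ forall (s0 : R) n w, 1 <= s0 ->
  `|Phi (w / sd s0 n) - (\sum_(k < n) p k.+1 * Phi ((w - Y k.+1) / sd s0 (n - k.+1)%N)
     + q n * Phi (w / s0))|
  <= C * ((sd s0 n ^+ 3)^-1 + s0^-1 * (n.+1%:R ^+ 2)^-1).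
Proof.
have sgg := ltW sg_gt0.
pose C0 := 3 * CY ^+ 3 + 18 * (sg * (1 + sg)) ^+ 2 + 2 * (sg * CY) + 2 * sg + CY + CY ^+ 2.
have h1 : 0 <= 3 * CY ^+ 3 by rewrite mulr_ge0 ?exprn_ge0.
have h2 : 0 <= CY ^+ 2 by rewrite exprn_ge0.
have h3 : 0 <= 18 * (sg * (1 + sg)) ^+ 2 by rewrite mulr_ge0 ?sqr_ge0.
have h4 : 0 <= 2 * (sg * CY) by rewrite !mulr_ge0.
have h5 : 0 <= 2 * sg by rewrite mulr_ge0.
have C00 : 0 <= C0 by rewrite !addr_ge0.
pose M4 := Ex (fun k => k.+1%:R ^+ 4).
have M40 : 0 <= M4 by apply: expect_ge0 => //; exact: poly_growthX.
exists (C0 * M4); split; first by rewrite mulr_ge0.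
move=> s0 n w s01.
have s00 : 0 < s0 by rewrite (lt_le_trans ltr01).
have ssd m : s0 <= sd s0 m by rewrite sd_ge// ltW.
have sd0 m : 0 < sd s0 m := lt_le_trans s00 (ssd m).
set s := sd s0 n; pose z := w / s.
pose T k := if (k <= n)%N then Phi ((w - Y k) / sd s0 (n - k)%N) else Phi (w / s0).
pose B k := Phi z - Y k * (phi z / s) - (Y k ^+ 2 - sg * k%:R) * (z * phi z / (2 * s ^+ 2)).
have gY := poly_growthY.
have gY2 : poly_growth (fun k => Y k ^+ 2) := poly_growthM gY gY.
have gX : poly_growth (fun k => k%:R : R) by exact: poly_growth_nat.
have gV : poly_growth (fun k => Y k ^+ 2 - sg * k%:R).
  rewrite (_ : (fun _ => _) = fun k => Y k ^+ 2 + (- sg) * k%:R).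
    by apply: poly_growthD => //; exact: poly_growthZ.
  by apply/funext => k; rewrite mulNr.
have gB1 (c : R) : poly_growth (fun k => Phi z + c * Y k).
  by apply: poly_growthD; [exact: poly_growth_cst|exact: poly_growthZ].
have BE : B = fun k => Phi z + (- (phi z / s)) * Y k
    + (- (z * phi z / (2 * s ^+ 2))) * (Y k ^+ 2 - sg * k%:R).
  by apply/funext => k; rewrite /B !mulNr !(mulrC (_ / _)).
have gB : poly_growth B by rewrite BE; apply: poly_growthD => //; exact: poly_growthZ.
have EB : Ex B = Phi z.
  rewrite BE expectD//; last exact: poly_growthZ.
  rewrite expectD; [|exact: poly_growth_cst|exact: poly_growthZ].
  rewrite expect_cst 2?expectZ// EY mulr0 addr0 expectB//; last exact: poly_growthZ.
  by rewrite expectZ// EY2 subrr mulr0 addr0.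
have gT : poly_growth T.
  apply: (@poly_growth_bnd _ 1) => k; rewrite /T.
  by case: ifP => _; rewrite ger0_norm ?std_normal_cdf_ge0 ?std_normal_cdf_le1.
have ET : Ex T = \sum_(k < n) p k.+1 * Phi ((w - Y k.+1) / sd s0 (n - k.+1)%N)
     + q n * Phi (w / s0).
  by rewrite tail_split big_ord_recl/= p0 mul0r add0r.
rewrite -ET -/z -EB distrC -expectB//.
have a0 : 0 <= (s ^+ 3)^-1 by rewrite invr_ge0 exprn_ge0// ltW// (sd0 n).
have b0 : 0 <= s0^-1 * (n.+1%:R ^+ 2)^-1 by rewrite mulr_ge0// invr_ge0 ?exprn_ge0// ltW.
set e := _ + _; have e0 : 0 <= e := addr_ge0 a0 b0.
have -> : C0 * M4 * e = Ex (fun k => C0 * e * k.+1%:R ^+ 4).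
  by rewrite expectZ; [rewrite mulrAC|exact: poly_growthX].
apply: expect_norm_le => [||k _].
- rewrite (_ : (fun _ => _) = fun k => T k + (-1) * B k).
    by apply: poly_growthD => //; exact: poly_growthZ.
  by apply/funext => k; rewrite mulN1r.
- exact/poly_growthZ/poly_growthX.
rewrite mulrAC; have K0 : 0 <= k.+1%:R ^+ 4 :> R by rewrite exprn_ge0.
rewrite /T /B; case: leqP => kn.
  apply: (le_trans (gauss_step_le w s01 kn)); apply: ler_pM => //; last by rewrite lerDl.
    by rewrite mulr_ge0// !addr_ge0.
  by rewrite ler_wpM2r// /C0 -[leRHS]addrA -[leRHS]addrA lerDl !addr_ge0.
apply: (le_trans (gauss_step_gt w s01 kn)); apply: ler_pM => //; last by rewrite lerDr.
  by rewrite mulr_ge0// !addr_ge0.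
by rewrite ler_wpM2r// /C0 lerD2r lerD2r lerDr !addr_ge0.
Qed.

Lemma sum_inv_cube (s0 : R) n : 1 <= s0 ->
  \sum_(i < n.+1) (sd s0 i ^+ 3)^-1 <= (1 + 2 / sg) / s0.
Proof.
move=> s01; have s00 : 0 < s0 by rewrite (lt_le_trans ltr01).
have sd0 m : 0 < sd s0 m by rewrite (lt_le_trans s00)// sd_ge// ltW.
have isg : 0 < sg^-1 by rewrite invr_gt0.
(* The sum telescopes: s^-1 - t^-1 = (t^2 - s^2) / (s t (s + t)) and t^2 - s^2 = sg
   for consecutive values s <= t of [sd s0]. *)
suff h : \sum_(i < n.+1) (sd s0 i ^+ 3)^-1 <= (1 + 2 / sg) / s0 - 2 / sg / sd s0 n.
  by rewrite (le_trans h)// gerBl !mulr_ge0 ?invr_ge0// ltW.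
elim: n => [|n IH].
  rewrite big_ord1 mulr0 addr0 sqrtr_sqr gtr0_norm// mulrDl addrK mul1r.
  by rewrite lef_pV2 ?posrE ?exprn_gt0// -[leLHS]expr1 ler_weXn2l.
rewrite big_ord_recr/= (le_trans (lerD IH (lexx _)))// {IH}.
have := sd0 n; have := sd0 n.+1; have := sd_sqr s0 n; have := sd_sqr s0 n.+1.
move: (sd s0 n) (sd s0 n.+1) => s t t2 s2 t0 s0'.
have st2 : t ^+ 2 = s ^+ 2 + sg by rewrite t2 s2 -natr1; lra.
have st : s <= t.
  by rewrite -(@ler_pXn2r _ 2) ?nnegrE ?(ltW s0') ?(ltW t0)// st2 lerDl ltW.
have is0 : 0 < s^-1 by rewrite invr_gt0.
have it0 : 0 < t^-1 by rewrite invr_gt0.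
have iss : s^-1 * s = 1 by rewrite mulVf// gt_eqF.
have itt : t^-1 * t = 1 by rewrite mulVf// gt_eqF.
have sgE : sg = (t - s) * (t + s) by move: st2; lra.
have k1 : (t ^+ 3)^-1 <= 2 / sg * (s^-1 - t^-1).
  have -> : s^-1 - t^-1 = (t - s) * (s^-1 * t^-1).
    have -> : s^-1 - t^-1 = s^-1 * (t^-1 * t) - t^-1 * (s^-1 * s) by rewrite iss itt !mulr1.
    move: s^-1 t^-1 => a b; lra.
  rewrite mulrAC ler_pdivlMr//.
  rewrite -exprVn sgE.
  have -> : t^-1 ^+ 3 * ((t - s) * (t + s)) = (t - s) * (t^-1 ^+ 2 * (t^-1 * t + t^-1 * s)).
    move: t^-1 => b; lra.
  have -> : 2 * ((t - s) * (s^-1 / t)) = (t - s) * (2 * (s^-1 / t)).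
    move: s^-1 t^-1 => a b; lra.
  rewrite ler_wpM2l ?subr_ge0// itt.
  have ts1 : t^-1 * s <= 1 by rewrite mulrC ler_pdivrMr// mul1r.
  have ii : t^-1 <= s^-1 by rewrite lef_pV2 ?posrE.
  apply: (@le_trans _ _ (t^-1 ^+ 2 * 2)).
    by rewrite ler_wpM2l ?exprn_ge0 ?(ltW it0)//; move: ts1; lra.
  by rewrite mulrC ler_wpM2l// expr2 ler_wpM2r// ltW.
move: k1; move: (t ^+ 3)^-1 (2 / sg) => T G; rewrite mulrBr; lra.
Qed.

(** * Propagation of the one-step defects *)

Section Expansion.
Variables (s0 : R) (F : nat -> R -> R).
Hypothesis s0_ge1 : 1 <= s0.
Hypothesis F0 : forall w, F 0%N w = Phi (w / s0).
Hypothesis FS : forall n w,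
  F n.+1 w = \sum_(k < n.+1) p k.+1 * F (n - k)%N (w - Y k.+1).

Lemma smoothed_bounds n : forall w, 0 <= F n w <= 1.
Proof.
elim/ltn_ind: n => -[_ w|n IH w].
  by rewrite F0 std_normal_cdf_ge0 std_normal_cdf_le1.
rewrite FS; apply/andP; split.
  apply: sumr_ge0 => k _; rewrite mulr_ge0//.
  by have /andP[] := IH (n - k)%N (leq_subr _ _) (w - Y k.+1).
apply: le_trans (sum_p_le1 n.+1); apply: ler_sum => k _; rewrite ler_piMr//.
by have /andP[] := IH (n - k)%N (leq_subr _ _) (w - Y k.+1).
Qed.

(** The constant [1 / s0] of the initial profile is inherited because the weights sum to at most 1.
    It makes a shift by [Y] a defect of order [1 / s0]. *)
Lemma smoothed_lip n : forall w w', `|F n w - F n w'| <= `|w - w'| / s0.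
Proof.
have s00 : 0 < s0 by rewrite (lt_le_trans ltr01).
elim/ltn_ind: n => -[_ w w'|n IH w w'].
  rewrite !F0 (le_trans (std_normal_cdf_lip _ _))// -mulrBl normrM.
  by rewrite (@gtr0_norm _ s0^-1) ?invr_gt0.
rewrite !FS -sumrB (le_trans (ler_norm_sum _ _ _))//.
apply: (@le_trans _ _ (\sum_(k < n.+1) p k.+1 * (`|w - w'| / s0))).
  apply: ler_sum => k _; rewrite -mulrBr normrM (ger0_norm (p_ge0 _)).
  rewrite ler_wpM2l// (le_trans (IH _ (leq_subr _ _) _ _))//.
  by rewrite opprB addrA subrK.
by rewrite -mulr_suml ler_piMl ?sum_p_le1// mulr_ge0// invr_ge0 ltW.
Qed.

(** Both quantities satisfy the same equation with the same boundary term, the Gaussian one up to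
    [e n]; by induction the defects accumulate at most additively. *)
Lemma smoothed_average (e : nat -> R) : (forall n, 0 <= e n) ->
  (forall n w, `|Phi (w / sd s0 n)
     - (\sum_(k < n) p k.+1 * Phi ((w - Y k.+1) / sd s0 (n - k.+1)%N)
        + q n * Phi (w / s0))| <= e n) ->
  forall n w, `|Phi (w / sd s0 n) - \sum_(i < n.+1) q i * F (n - i)%N w| <=
    \sum_(i < n.+1) e i.
Proof.
move=> e0 He n; elim/ltn_ind: n => -[_ w|n IH w].
  have s00 : 0 < s0 by rewrite (lt_le_trans ltr01).
  rewrite !big_ord1 F0 mulr0 addr0 sqrtr_sqr (gtr0_norm s00) tail0 mul1r subrr normr0.
  exact: e0.
rewrite (@average_rec Y F n w FS) F0 [leRHS]big_ord_recr/= [leRHS]addrC.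
have := He n.+1 w; set G := Phi _; set q1 := q n.+1 * _.
set S1 := \sum_(k < n.+1) _ * Phi _.
set S2 := \sum_(k < n.+1) _ * (\sum_(i < _) _) => h.
have -> : G - (S2 + q1) = (G - (S1 + q1)) + (S1 - S2) by lra.
apply: (le_trans (ler_normD _ _)); apply: lerD => //.
rewrite /S1 /S2 -sumrB; apply: (le_trans (ler_norm_sum _ _ _)).
apply: (@le_trans _ _ (\sum_(k < n.+1) p k.+1 * (\sum_(i < n.+1) e i))); last first.
  by rewrite -mulr_suml ler_piMl ?sum_p_le1// sumr_ge0.
apply: ler_sum => k _; rewrite -mulrBr normrM (ger0_norm (p_ge0 _)) ler_wpM2l//.
rewrite subSS; apply: (le_trans (IH (n - k)%N (leq_subr _ _) (w - Y k.+1))).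
rewrite [leRHS](bigID (fun i : 'I_n.+1 => (i < (n - k).+1)%N))/=.
by rewrite -(big_ord_widen _ e) ?ltnS ?leq_subr// lerDl sumr_ge0.
Qed.

End Expansion.

(** [renewal_average] replaces [E[X] F n] by the average against [q], and [smoothed_average]
    compares this average with the Gaussian. *)
Lemma renewal_clt : exists C, 0 <= C /\ forall (s0 : R) (F : nat -> R -> R), 1 <= s0 ->
  (forall w, F 0%N w = Phi (w / s0)) ->
  (forall n w, F n.+1 w = \sum_(k < n.+1) p k.+1 * F (n - k)%N (w - Y k.+1)) ->
  forall n w, `|Ex (fun k => k%:R) * F n w - Phi (w / sd s0 n)| <=
    C * (s0^-1 + n.+1%:R^-1).
Proof.
have [C [C0 hC]] := renewal_average.
have [D [D0 hD]] := gauss_defect.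
have [M hM] := p_mom 1.
have M0 : 0 <= M by have := hM 0%N; rewrite big_geq.
have isg : 0 < sg^-1 by rewrite invr_gt0.
have P1 : 0 <= CY * M + 1 by rewrite addr_ge0// mulr_ge0.
have P2 : 0 <= 3 + 2 / sg by rewrite addr_ge0// mulr_ge0// ltW.
exists (C * (CY * M + 1) + D * (3 + 2 / sg)); split; first by rewrite addr_ge0// mulr_ge0.
move=> s0 F s01 F0 FS n w.
have s00 : 0 < s0 by rewrite (lt_le_trans ltr01).
have i0 : 0 < s0^-1 by rewrite invr_gt0.
have v0 : 0 < n.+1%:R^-1 :> R by rewrite invr_gt0.
(* For fixed [w], dropping the shifts by [Y k] costs at most [CY * M / s0], which is taken as
   [eta]. *)
have h1 : `|Ex (fun k => k%:R) * F n w - \sum_(i < n.+1) q i * F (n - i)%N w| <=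
    C * (CY * M / s0 + n.+1%:R^-1).
  apply: (hC (F^~ w)) => [||m].
  - by rewrite !mulr_ge0// ltW.
  - by move=> m; exact: smoothed_bounds F0 FS m w.
  - rewrite FS -sumrB (le_trans (ler_norm_sum _ _ _))//.
    apply: (@le_trans _ _ (\sum_(k < m.+1) CY / s0 * (p k.+1 * k.+2%:R ^+ 1))).
      apply: ler_sum => k _; rewrite -mulrBr normrM (ger0_norm (p_ge0 _)) mulrCA ler_wpM2l//.
      rewrite (le_trans (smoothed_lip s01 F0 FS _ _ _))// mulrAC ler_wpM2r ?(ltW i0)//.
      by rewrite addrC addKr normrN expr1.
    rewrite -mulr_sumr mulrAC ler_wpM2r ?(ltW i0)// ler_wpM2l//.
    have := hM m.+2; rewrite big_mkord big_ord_recl/= p0 mul0r add0r.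
    by apply: le_trans; rewrite le_eqVlt; apply/orP; left.
pose e m := D * ((sd s0 m ^+ 3)^-1 + s0^-1 * (m.+1%:R ^+ 2)^-1).
have e0 m : 0 <= e m.
  by rewrite mulr_ge0// addr_ge0 ?mulr_ge0// ?invr_ge0 ?exprn_ge0// ltW.
have h2 := smoothed_average s01 F0 FS e0 (fun m w => hD s0 m w s01) n w.
have h3 : \sum_(i < n.+1) e i <= D * (3 + 2 / sg) / s0.
  rewrite /e -mulr_sumr big_split/= -mulr_sumr -mulrA ler_wpM2l//.
  have := sum_inv_cube n s01.
  have := ler_wpM2l (ltW i0) (sum_inv_sqr_le2 R n.+1).
  move: (\sum_(i < _) _) (s0^-1 * \sum_(i < _) _) => A B; move: (2 / sg) s0^-1 => a b; lra.
have := ler_normB (Ex (fun k => k%:R) * F n w - \sum_(i < n.+1) q i * F (n - i)%N w)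
  (Phi (w / sd s0 n) - \sum_(i < n.+1) q i * F (n - i)%N w).
have := le_trans h2 h3; move: h1.
have : 0 <= C * n.+1%:R^-1 * (CY * M) by rewrite !mulr_ge0// ltW.
have : 0 <= C * s0^-1 by rewrite mulr_ge0// ltW.
have : 0 <= D * (3 + 2 / sg) * n.+1%:R^-1 by rewrite mulr_ge0 ?(ltW v0)// mulr_ge0.
move: (Ex _ * _) (\sum_(i < _) _) (Phi _) => A B G.
have -> : A - B - (G - B) = A - G by lra.
move: (D * _) n.+1%:R^-1 s0^-1 => D' v i; lra.
Qed.

End Renewal.

End Law.

(** * Compositions and the weights of their parts *)

(** Induction on [D]: with [s] midway between [r] and 1, the factor [(r / s)^k] absorbs one power of
    [k + 1] by [expr_onem_le]. *)
Lemma expr_poly_le_geometric (R : realType) D (r : R) : 0 < r < 1 ->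
  exists C t, [/\ 0 <= C, 0 < t < 1 & forall k, r ^+ k * k.+1%:R ^+ D <= C * t ^+ k].
Proof.
elim: D r => [|D IH] r /andP[r0 r1].
  by exists 1, r; split; rewrite ?r0// => k; rewrite expr0 mulr1 mul1r.
pose s := (1 + r) / 2.
have s01 : 0 < s < 1 by rewrite /s; lra.
have [C [t [C0 t01 h]]] := IH s s01.
have [s0 s1] := andP s01.
have rs : r / s < 1 by rewrite ltr_pdivrMr// mul1r /s; lra.
have rs0 : 0 < r / s by rewrite divr_gt0.
have e01 : 0 < 1 - r / s < 1 by rewrite subr_gt0 rs/= gtrBl.
have e0 : 0 <= (1 - r / s)^-1 by rewrite invr_ge0; case/andP: e01 => /ltW.
exists ((1 - r / s)^-1 * C), t; split=> //; first by rewrite mulr_ge0.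
move=> k; have := expr_onem_le k e01; rewrite opprB addrC subrK => hk.
have -> : r ^+ k = (r / s) ^+ k * s ^+ k by rewrite -exprMn divfK// gt_eqF.
rewrite exprS mulrACA -[leRHS]mulrA.
have a0 : 0 <= (r / s) ^+ k * k.+1%:R by rewrite mulr_ge0 ?exprn_ge0// ltW.
have b0 : 0 <= s ^+ k * k.+1%:R ^+ D by rewrite mulr_ge0 ?exprn_ge0// ltW.
exact: ler_pM a0 b0 hk (h k).
Qed.

Lemma cofinite_bound (S : set nat) : finite_set (posnat `\` S) ->
  exists2 K, (0 < K)%N & forall k, (K <= k)%N -> S k.
Proof.
move=> fS; exists (\max_(i <- fset_set (posnat `\` S)) i).+1 => // k Kk.
apply: contrapT => nS.
have : k \in fset_set (posnat `\` S).
  by rewrite in_fset_set// inE; split => //; rewrite /posnat/= (leq_ltn_trans _ Kk).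
move=> kX; have := @leq_bigmax_seq _ _ xpredT id k kX isT.
by rewrite leqNgt Kk.
Qed.

(** * The law of the parts of a cofinite set *)

Section CofiniteLaw.
Variables (R : realType) (S : set nat) (K : nat).
Hypothesis S_pos : S `<=` posnat.
Hypothesis K_gt0 : (0 < K)%N.
Hypothesis S_ge : forall k, (K <= k)%N -> S k.

Definition part_weight (r : R) k : R := (k \in S)%:R * r ^+ k.

Lemma part_weight_ge0 r k : 0 <= r -> 0 <= part_weight r k.
Proof. by move=> r0; rewrite mulr_ge0// exprn_ge0. Qed.

Lemma part_weight_le r k : 0 <= r -> part_weight r k <= r ^+ k.
Proof. by move=> r0; rewrite ler_piMl ?exprn_ge0// lern1 leq_b1. Qed.

Lemma part_weight_geK r k : (K <= k)%N -> part_weight r k = r ^+ k.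
Proof. by move=> /S_ge Sk; rewrite /part_weight mem_set// mul1r. Qed.

Lemma part_weight0 r : part_weight r 0 = 0.
Proof. by rewrite /part_weight memNset ?mul0r// => /S_pos. Qed.

(** All integers from [K] on are parts, and [r ^+ K / (1 - r)] is their total weight; the identity
    thus says that the weights of all parts sum to 1. *)
Lemma part_weight_root : exists2 r : R, 0 < r < 1 &
  \sum_(k < K) part_weight r k = 1 - r ^+ K / (1 - r).
Proof.
(* [P.[r]] is (1 - r) (sum_(k in S) r^k - 1). *)
pose P : {poly R} := (1 - 'X) * (\sum_(k < K) ((k : nat) \in S)%:R *: 'X^k) + 'X^K - (1 - 'X).
have PE x : P.[x] = (1 - x) * (\sum_(k < K) part_weight x k) + x ^+ K - (1 - x).
  rewrite /P !hornerE horner_sum; congr ((1 - _) * _ + _ - _).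
  by apply: eq_bigr => k _; rewrite !hornerE.
have P0 : P.[0] = - 1.
  rewrite PE expr0n gtn_eqF// mulr0n big1 => [|[[|k] kK] _]; last 2 first.
  - exact: part_weight0.
  - by rewrite /part_weight expr0n mulr0.
  lra.
have P1 : P.[1] = 1 by rewrite PE expr1n; lra.
have [||r /andP[r0 r1] /rootP Pr] := @poly_ivt _ P 0 1.
- exact: ler01.
- by rewrite P0 P1; lra.
have rn0 : r != 0 by apply/eqP => r00; move: Pr; rewrite r00 P0; lra.
have rn1 : r != 1 by apply/eqP => r11; move: Pr; rewrite r11 P1; lra.
have r01 : 0 < r < 1 by rewrite !lt_neqAle r0 r1 eq_sym rn0 rn1.
exists r => //; have /andP[_ r1'] := r01.
have o0 : 1 - r != 0 by rewrite subr_eq0 eq_sym.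
apply: (mulfI o0); rewrite mulrBr mulr1 mulrCA divff// mulr1.
move: Pr; rewrite PE; lra.
Qed.

Section Weight.
Variable r : R.
Hypothesis r01 : 0 < r < 1.
Hypothesis r_root : \sum_(k < K) part_weight r k = 1 - r ^+ K / (1 - r).
Local Notation p := (part_weight r).
Let r_gt0 : 0 < r. Proof. by case/andP: r01. Qed.
Let r_lt1 : r < 1. Proof. by case/andP: r01. Qed.

Lemma sum_part_weight n : (K <= n)%N -> \sum_(k < n) p k = 1 - r ^+ n / (1 - r).
Proof.
move=> /subnK <-; elim: (n - K)%N => [|j IH]; first by rewrite add0n.
rewrite addSn big_ord_recr/= IH part_weight_geK ?leq_addl// exprS.
have o0 : 1 - r != 0 by rewrite subr_eq0 eq_sym lt_eqF.
move: (r ^+ _) => x.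
have -> : x = (1 - r) * x / (1 - r) by rewrite mulrAC divff// mul1r.
rewrite -addrA -mulNr -mulrDl; congr (_ + _); rewrite mulrAC divff// mul1r.
by rewrite -mulNr; congr (_ / _); lra.
Qed.

Lemma cvg_sum_part_weight : series p @ \oo --> (1 : R).
Proof.
have h : 1 - r ^+ n / (1 - r) @[n --> \oo] --> (1 - 0 / (1 - r) : R).
  apply: cvgB; first exact: cvg_cst.
  apply: cvgM; last exact: cvg_cst.
  by apply: cvg_expr; rewrite gtr0_norm.
rewrite mul0r subr0 in h; apply: cvg_trans h; apply: near_eq_cvg; near=> n.
rewrite /series/= big_mkord sum_part_weight//.
by near: n; exact: nbhs_infty_ge.
Unshelve. all: by end_near. Qed.

Lemma part_weight_moment D : exists M, forall n,
  \sum_(0 <= k < n) p k * k.+1%:R ^+ D <= M.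
Proof.
have [C [t [C0 /andP[t0 t1] h]]] := expr_poly_le_geometric D r01.
exists (C * (1 - t)^-1) => n.
apply: (@le_trans _ _ (\sum_(0 <= k < n) C * t ^+ k)).
  apply: ler_sum => k _; apply: le_trans (h k).
  by rewrite ler_wpM2r ?exprn_ge0// part_weight_le// ltW.
have tn1 : t != 1 by rewrite lt_eqF.
have := @geometric_seriesE R 1 t tn1 => /(congr1 (fun f => f n)).
rewrite /series/= mul1r => e.
rewrite -mulr_sumr ler_wpM2l//.
under eq_bigr do rewrite -[t ^+ _]mul1r.
rewrite e ler_piMl//; first by rewrite invr_ge0 subr_ge0 ltW.
by rewrite gerBl exprn_ge0// ltW.
Qed.

Let p_ge0 k : 0 <= p k. Proof. by rewrite part_weight_ge0// ltW. Qed.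
Let p0 : p 0 = 0 := part_weight0 r.
Let q_rec := tailS p_ge0 p0 part_weight_moment.

(** The tail is exactly geometric once [a + 1 >= K]. Smaller ages follow by descending induction,
    each step adding a weight of at most [r ^+ a.+1]. *)
Lemma tail_part_weight a : 0 < tail p a <= r ^+ a.+1 / (1 - r).
Proof.
have o0 : 0 < 1 - r by rewrite subr_gt0.
have base b : (K <= b.+1)%N -> tail p b = r ^+ b.+1 / (1 - r).
  move=> Kb; have := sum_p_tail p_ge0 p0 cvg_sum_part_weight part_weight_moment b.
  have := sum_part_weight Kb; rewrite big_ord_recl/= p0 add0r; lra.
have : (K <= a.+1 + K)%N by rewrite leq_addl.
elim: {2}K a => [|d IH] a.
  by rewrite addn0 => /base ->; rewrite lexx andbT divr_gt0// exprn_gt0.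
rewrite addnS -addSn => /IH/andP[h1 h2]; rewrite q_rec.
rewrite ltr_wpDl//= (@le_trans _ _ (r ^+ a.+1 + r ^+ a.+2 / (1 - r)))//.
  by rewrite lerD// part_weight_le// ltW.
rewrite [r ^+ a.+2]exprS ler_pdivlMr// mulrDl divfK ?gt_eqF//; lra.
Qed.

(** [a + K] is always a part, and [r ^+ (a + K)] is [r ^+ K.-1] times [r ^+ a.+1], which bounds
    [(1 - r) * tail p a]. *)
Lemma part_weight_doeblin a :
  (r ^+ K.-1 * (1 - r)) * tail p a <= p (a + K)%N.
Proof.
have o0 : 0 < 1 - r by rewrite subr_gt0.
have /andP[_ h] := tail_part_weight a.
rewrite part_weight_geK ?leq_addl//.
have -> : (a + K = a.+1 + K.-1)%N by rewrite addSnnS prednK.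
rewrite exprD [leRHS]mulrC -mulrA ler_wpM2l ?exprn_ge0 ?(ltW r_gt0)//.
by rewrite mulrC -ler_pdivlMr.
Qed.

Lemma part_weight_doeblin_cst : 0 < r ^+ K.-1 * (1 - r) < 1.
Proof.
have o0 : 0 < 1 - r by rewrite subr_gt0.
rewrite mulr_gt0 ?exprn_gt0//= (@le_lt_trans _ _ (1 - r))//.
  by rewrite ler_piMl ?(ltW o0)// exprn_ile1// ltW.
by rewrite gtrBl.
Qed.

End Weight.
End CofiniteLaw.

(** * Enumeration of compositions by their first part *)

Section Compositions.
Variables (R : realType) (S : set nat).
Hypothesis S_pos : S `<=` posnat.

Definition comp_seq n : seq (seq nat) := fset_set (compositions S n).

Lemma mem_comp_seq n l : (l \in comp_seq n) = (l \in compositions S n).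
Proof. by rewrite /comp_seq in_fset_set//; exact: finite_compositions. Qed.

Lemma comp_seq0 : comp_seq 0 = [:: [::]].
Proof.
apply: perm_small_eq => //; apply: uniq_perm => //; first exact: fset_uniq.
move=> l; rewrite mem_comp_seq !inE; apply/idP/eqP => [/set_mem[lS]|->].
  case: l lS => // k l lS /=; have := S_pos (lS k (mem_head _ _)).
  by rewrite /posnat/=; case: k {lS}.
by apply/mem_set; split.
Qed.

Lemma sum_comp_seqS n (h : seq nat -> R) : \sum_(l <- comp_seq n.+1) h l =
  \sum_(k < n.+1) (k.+1 \in S)%:R * \sum_(l <- comp_seq (n - k)) h (k.+1 :: l).
Proof.
pose s := [seq k.+1 :: l | k <- [seq k <- index_iota 0 n.+1 | k.+1 \in S],
                           l <- comp_seq (n - k)].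
have ps : perm_eq (comp_seq n.+1) s.
  apply: uniq_perm; first exact: fset_uniq.
    apply: allpairs_uniq_dep => [|k _|].
    - by rewrite filter_uniq ?iota_uniq.
    - exact: fset_uniq.
    - by move=> [k l] [k' l'] _ _ /= [-> ->].
  move=> l; rewrite mem_comp_seq; apply/idP/idP => [/set_mem[lS ln]|].
    case: l lS ln => // k l lS /= ln.
    have kpos := S_pos (lS k (mem_head _ _)); rewrite /posnat/= in kpos.
    apply/allpairsPdep; exists k.-1, l; rewrite prednK//; split => //.
      rewrite mem_filter prednK// mem_set ?mem_index_iota/=; last exact/lS/mem_head.
      by move: kpos ln; clear; lia.
    rewrite mem_comp_seq; apply/mem_set; split.
      by move=> j jl; apply: lS; rewrite inE jl orbT.
    by move: kpos ln; clear; lia.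
  move=> /allpairsPdep[k [l' [+ + ->]]].
  rewrite mem_filter mem_index_iota/= => /andP[/set_mem kS kn].
  rewrite mem_comp_seq => /set_mem[l'S l'n].
  apply/mem_set; split => [j|/=]; last by rewrite l'n; move: kn; clear; lia.
  by rewrite inE => /predU1P[->//|]; exact: l'S.
rewrite (perm_big _ ps) /s big_allpairs_dep big_filter big_mkcond big_mkord.
apply: eq_bigr => k _.
by case: (_ \in S); rewrite ?mul1r ?mul0r.
Qed.

Lemma uniform_on_comp n (E : set (seq nat)) : uniform_on R (compositions S n) E =
  (\sum_(l <- comp_seq n) (l \in E)%:R) / (size (comp_seq n))%:R.
Proof.
rewrite /uniform_on; congr (_ / _).
have -> : \sum_(l <- comp_seq n) (l \in E)%:R = (count (mem E) (comp_seq n))%:R :> R.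
  by elim: (comp_seq n) => [|l s IH]; rewrite ?big_nil// big_cons IH -natrD.
rewrite -size_filter; congr (_%:R); apply: perm_size.
apply: uniq_perm; rewrite ?filter_uniq ?fset_uniq// => l.
rewrite mem_filter mem_comp_seq in_fset_set ?in_setI 1?andbC//.
exact/finite_setIl/finite_compositions.
Qed.

End Compositions.

(** Splitting [r ^+ n.+1] between the first part and the rest makes the weighted sum over
    compositions a solution of the renewal equation with shifts [Y]. *)
Lemma comp_seq_rec (R : realType) (S : set nat) (r : R) (Y : nat -> R) (g : R -> R)
    n w : S `<=` posnat ->
  r ^+ n.+1 * (\sum_(l <- comp_seq S n.+1) g (w - \sum_(k <- l) Y k)) =
  \sum_(k < n.+1) part_weight S r k.+1 *
    (r ^+ (n - k) * \sum_(l <- comp_seq S (n - k)) g (w - Y k.+1 - \sum_(j <- l) Y j)).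
Proof.
move=> S_pos; rewrite sum_comp_seqS// mulr_sumr; apply: eq_bigr => k _.
have -> : r ^+ n.+1 = r ^+ k.+1 * r ^+ (n - k).
  by rewrite -exprD; congr (_ ^+ _); have := ltn_ord k; lia.
under eq_bigr do rewrite big_cons opprD addrA.
rewrite /part_weight; move: (\sum_(l <- _) _) (_ \in S)%:R (r ^+ _) (r ^+ _) => A B C D.
lra.
Qed.

Lemma sum_parts_ln (R : realType) (S : set nat) (a : R) n l : S `<=` posnat ->
  compositions S n l ->
  \sum_(k <- l) (ln k%:R - a * k%:R) = ln (prodparts l)%:R - a * n%:R.
Proof.
move=> S_pos [lS <-].
have l_pos k : k \in l -> (0 < k)%N by move=> /lS/S_pos.
elim: l l_pos {lS} => [|k l IH] l_pos.
  by rewrite big_nil /prodparts big_nil ln1 mulr0 subrr.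
have k0 : (0 < k)%N by rewrite l_pos// mem_head.
have l0 j : j \in l -> (0 < j)%N by move=> jl; rewrite l_pos// inE jl orbT.
have pl0 : (0 < prodparts l)%N.
  by rewrite /prodparts big_seq; apply: prodn_cond_gt0 => j /l0.
rewrite big_cons IH// /prodparts big_cons -/(prodparts l) natrM lnM ?posrE ?ltr0n//.
rewrite /= natrD; lra.
Qed.

(** The indicator of [y <= w] lies between normal profiles centred at [w - h] and [w + h], up to the
    normal tail beyond [h / s0]. *)
Lemma std_normal_smoothing (R : realType) (s : seq R) (w h s0 : R) : 0 < h -> 0 < s0 ->
  let t := 8 / (h / s0) ^+ 2 * (size s)%:R in
  \sum_(y <- s) std_normal_cdf ((w - h - y) / s0) - t <= \sum_(y <- s) (y <= w)%R%:R
  <= \sum_(y <- s) std_normal_cdf ((w + h - y) / s0) + t.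
Proof.
move=> h0 s00 /=; set t := 8 / _.
have hs : 0 < h / s0 by rewrite divr_gt0.
have [t1 t2] := std_normal_cdf_tail hs; rewrite -/t in t1 t2.
have -> : t * (size s)%:R = \sum_(y <- s) t.
  by rewrite big_const_seq count_predT iter_addr_0 mulr_natr.
rewrite -sumrB -big_split/=; apply/andP; split; apply: ler_sum => y _.
  have [yw|yw] := leP y w.
    by have := std_normal_cdf_le1 ((w - h - y) / s0);
      have := std_normal_cdf_ge0 (- (h / s0)); rewrite -/t /=; lra.
  rewrite lerBlDr add0r (le_trans _ t2)// std_normal_cdf_nd// -mulNr.
  by rewrite ler_pM2r ?invr_gt0//; lra.
have [yw|yw] := leP y w; last first.
  rewrite addr_ge0 ?std_normal_cdf_ge0// (le_trans _ t2)// std_normal_cdf_ge0//.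
rewrite -lerBlDr (le_trans _ (std_normal_cdf_nd (_ : h / s0 <= _)))//.
  by rewrite lerBlDr -lerBlDl.
by rewrite ler_pM2r ?invr_gt0//; lra.
Qed.

(** Removes the smoothing variance [d]: the ratio [c] of the deviations satisfies
    [c - 1 <= c^2 - 1 = d / v]. *)
Lemma std_normal_cdf_rescale (R : realType) (w v d : R) : 0 < v -> 0 <= d ->
  `|std_normal_cdf (w / Num.sqrt (d + v)) - std_normal_cdf (w / Num.sqrt v)| <= d / v.
Proof.
move=> v0 d0; have dv0 : 0 < d + v by rewrite ltr_wpDl.
have sv : 0 < Num.sqrt v by rewrite sqrtr_gt0.
have sdv : 0 < Num.sqrt (d + v) by rewrite sqrtr_gt0.
pose c := Num.sqrt (d + v) / Num.sqrt v.
have c1 : 1 <= c by rewrite ler_pdivlMr// mul1r ler_wsqrtr// lerDr.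
have -> : w / Num.sqrt v = w / Num.sqrt (d + v) * c.
  by rewrite /c mulrA divfK// gt_eqF.
rewrite distrC (le_trans (std_normal_cdf_scale_lip _ c1))//.
apply: (@le_trans _ _ (c ^+ 2 - 1)); first by have := sqr_ge0 (c - 1); lra.
rewrite /c exprMn exprVn !sqr_sqrtr ?(ltW dv0) ?(ltW v0)// mulrDl divff ?gt_eqF//.
by rewrite addrK.
Qed.

(** * Drift, variance and the Kolmogorov distance for compositions *)

Lemma part_weight_drift (R : realType) (S : set nat) (K : nat) (r : R) :
  S `<=` posnat -> (0 < K)%N -> (forall k, (K <= k)%N -> S k) -> 0 < r < 1 ->
  \sum_(k < K) part_weight S r k = 1 - r ^+ K / (1 - r) ->
  let Ex := expect (part_weight S r) in
  let Y a k : R := ln k%:R - a * k%:R in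
  exists a sg : R, [/\ 0 < a, 0 < sg, forall k, `|Y a k| <= (1 + a) * k.+1%:R,
    Ex (Y a) = 0 & Ex (fun k => Y a k ^+ 2) = sg * Ex (fun k => k%:R)].
Proof.
move=> S_pos K0 SK r01 rr Ex Y; have /andP[r0 _] := r01.
set p := part_weight S r in Ex *.
have p_ge0 k : 0 <= p k by rewrite part_weight_ge0// ltW.
have p0 : p 0%N = 0 := part_weight0 S_pos r.
have p_sum := cvg_sum_part_weight SK r01 rr.
have p_mom := part_weight_moment S r01.
have ln_ge0 k : 0 <= ln k%:R :> R.
  case: k => [|k]; first by rewrite ln0.
  by rewrite ln_ge0// ler1n.
have ln_le k : ln k%:R <= k%:R :> R.
  case: k => [|k]; first by rewrite ln0.
  rewrite -nat1r (le_trans (le_ln1Dx _)) ?lerDr//.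
  by rewrite (lt_le_trans (ltrN10 R)).
have gln : poly_growth (fun k => ln k%:R : R).
  by apply: poly_growth_le (poly_growth_nat R (fun k => leqnn k)) => k; rewrite ger0_norm.
have gX : poly_growth (fun k => k%:R : R) := poly_growth_nat R (fun k => leqnn k).
have m1 : 1 <= Ex (fun k => k%:R).
  rewrite -[leLHS](expect_cst p_sum); apply: expect_le => //; first exact: poly_growth_cst.
  by move=> k k0; rewrite ler1n.
have m0 : 0 < Ex (fun k => k%:R) := lt_le_trans ltr01 m1.
have pK k : (K <= k)%N -> 0 < p k.
  by move=> Kk; rewrite /p (part_weight_geK SK)// exprn_gt0.
pose a := Ex (fun k => ln k%:R) / Ex (fun k => k%:R).
(* The single part [K + 1 >= 2], whose logarithm is positive, bounds the expectation from below. *)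
have a0 : 0 < a.
  rewrite divr_gt0//.
  apply: (@lt_le_trans _ _ (p K.+1 * ln K.+1%:R)).
    by rewrite mulr_gt0 ?pK// ln_gt0// ltr1n.
  by apply: expect_ge_term => // j _; exact: ln_ge0.
have gY : poly_growth (Y a).
  rewrite (_ : Y a = fun k => ln k%:R + (- a) * k%:R).
    by apply: poly_growthD => //; exact: poly_growthZ.
  by apply/funext => k; rewrite /Y mulNr.
have gY2 : poly_growth (fun k => Y a k ^+ 2) := poly_growthM gY gY.
have Y2_ge0 k : 0 <= Y a k ^+ 2 by rewrite sqr_ge0.
pose sg := Ex (fun k => Y a k ^+ 2) / Ex (fun k => k%:R).
exists a, sg; split => //.
- rewrite divr_gt0//.
  have [k Kk Yk] : exists2 k, (K <= k)%N & Y a k != 0.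
    (* If Y vanished at both k and 2 k, then ln 2 = ln k. *)
    apply: contrapT => nY.
    have Y0 k : (K <= k)%N -> ln k%:R = a * k%:R.
      move=> Kk; apply/eqP; rewrite -subr_eq0; apply/negPn/negP => Yk.
      by apply: nY; exists k.
    (* [K + 2] differs from 2 because [K > 0]. *)
    have h1 := Y0 (K + 2)%N (leq_addr _ _).
    have h2 := Y0 ((K + 2) * 2)%N.
    have : ln ((K + 2) * 2)%:R = ln (K + 2)%:R + ln (K + 2)%:R :> R.
      by rewrite h2 ?h1 ?natrM; [lra|lia].
    rewrite natrM lnM ?posrE ?ltr0n ?addn2// => /addrI/(@ln_inj R).
    rewrite !posrE !ltr0n => /(_ erefl erefl)/eqP; rewrite eqr_nat => /eqP[K00].
    by rewrite -K00 in K0.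
  apply: (@lt_le_trans _ _ (p k * Y a k ^+ 2)).
    by rewrite mulr_gt0 ?pK// exprn_even_gt0.
  by apply: expect_ge_term.
- move=> k; rewrite mulrDl mul1r (le_trans (ler_normB _ _))// lerD//.
    by rewrite ger0_norm// (le_trans (ln_le k))// ler_nat.
  by rewrite normrM (gtr0_norm a0) ger0_norm// (ler_wpM2l (ltW a0))// ler_nat.
- rewrite /Ex expectB//; last exact: poly_growthZ.
  by rewrite expectZ// divfK ?subrr// gt_eqF.
- by rewrite divfK// gt_eqF.
Qed.

(** The five errors come, in order, from the renewal density, the smoothed limit theorem, the normal
    tails, the shift by [h], and the smoothing variance. The condition [C2 < n.+1] forces
    compositions of [n] to exist, so the division by their number is genuine. *)
Lemma comp_kolmogorov (R : realType) (S : set nat) (K : nat) (r a sg : R) :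
  S `<=` posnat -> (0 < K)%N -> (forall k, (K <= k)%N -> S k) -> 0 < r < 1 ->
  \sum_(k < K) part_weight S r k = 1 - r ^+ K / (1 - r) ->
  let Ex := expect (part_weight S r) in
  let Y k : R := ln k%:R - a * k%:R in
  0 < a -> 0 < sg -> (forall k, `|Y k| <= (1 + a) * k.+1%:R) ->
  Ex Y = 0 -> Ex (fun k => Y k ^+ 2) = sg * Ex (fun k => k%:R) ->
  exists C1 C2 : R, [/\ 0 <= C1, 0 <= C2 & forall (s0 h : R) n x,
    1 <= s0 -> 0 < h -> (0 < n)%N -> C2 < n.+1%:R ->
    `|uniform_on R (compositions S n)
        [set l | (ln (prodparts l)%:R - a * n%:R) / Num.sqrt (sg * n%:R) <= x]
      - std_normal_cdf x| <=
    C2 / n.+1%:R + C1 * (s0^-1 + n.+1%:R^-1) + 8 / (h / s0) ^+ 2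
      + h / Num.sqrt (sg * n%:R) + s0 ^+ 2 / (sg * n%:R)].
Proof.
move=> S_pos K0 SK r01 rr Ex Y a0 sg0 Yle EY EY2; have /andP[r0 r1] := r01.
set p := part_weight S r in Ex EY EY2 *.
have p_ge0 k : 0 <= p k by rewrite part_weight_ge0// ltW.
have p0 : p 0%N = 0 := part_weight0 S_pos r.
have p_sum := cvg_sum_part_weight SK r01 rr.
have p_mom := part_weight_moment S r01.
have q0 k : 0 < tail p k.
  by have /andP[] := tail_part_weight S_pos SK r01 rr k.
have eps01 := part_weight_doeblin_cst K r01.
have dbl := part_weight_doeblin S_pos K0 SK r01 rr.
have CY0 : 0 <= 1 + a by rewrite addr_ge0// ltW.
have [C1 [C10 clt]] :=
  renewal_clt p_ge0 p0 p_sum p_mom K0 eps01 dbl q0 CY0 Yle sg0 EY EY2.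
have [C2 [C20 dens]] := renewal_density p_ge0 p0 p_sum p_mom K0 eps01 dbl q0.
exists C1, C2; split=> // s0 h n x s01 h0 n0 nC2.
have s00 : 0 < s0 := lt_le_trans ltr01 s01.
pose L := comp_seq S; pose W l := \sum_(k <- l) Y k.
pose c : R := (size (L n))%:R.
pose u n := r ^+ n * (size (L n))%:R.
pose m := Ex (fun k => k%:R).
have un : `|m * u n - 1| <= C2 / n.+1%:R.
  apply: dens => [|j].
    by rewrite /u /L comp_seq0// expr0 mul1r.
  have sz i : (size (L i))%:R = \sum_(l <- L i) 1 :> R.
    by rewrite big_const_seq count_predT iter_addr_0.
  rewrite /u sz (comp_seq_rec r Y (fun=> 1) j 0 S_pos).
  by apply: eq_bigr => k _; rewrite sz.
have c0 : 0 < c.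
  rewrite ltr0n lt0n; apply/negP => /eqP sz0.
  move: un; rewrite /u sz0 !mulr0 sub0r normrN1 leNgt ltr_pdivrMr ?ltr0n//.
  by rewrite mul1r nC2.
pose G w := \sum_(l <- L n) std_normal_cdf ((w - W l) / s0).
have G01 w : 0 <= G w / c <= 1.
  apply/andP; split.
    rewrite divr_ge0 ?(ltW c0)//; apply: sumr_ge0 => l _; exact: std_normal_cdf_ge0.
  rewrite ler_pdivrMr// mul1r /G /c.
  have -> : (size (L n))%:R = \sum_(l <- L n) 1 :> R.
    by rewrite big_const_seq count_predT iter_addr_0.
  apply: ler_sum => l _; exact: std_normal_cdf_le1.
pose sd := Num.sqrt (s0 ^+ 2 + sg * n%:R).
have GA w : `|G w / c - std_normal_cdf (w / sd)| <=
    C2 / n.+1%:R + C1 * (s0^-1 + n.+1%:R^-1).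
  (* [F n w] is [u n] times the smoothed distribution [G w / c]; as [m * u n] is close to 1,
     [m * F n w] approximates the latter. *)
  pose F i w := r ^+ i * \sum_(l <- L i) std_normal_cdf ((w - W l) / s0).
  have F0 v : F 0%N v = std_normal_cdf (v / s0).
    by rewrite /F /L comp_seq0// expr0 mul1r big_seq1 /W big_nil subr0.
  have FS i v : F i.+1 v = \sum_(k < i.+1) p k.+1 * F (i - k)%N (v - Y k.+1).
    exact: (comp_seq_rec r Y (fun y => std_normal_cdf (y / s0)) i v S_pos).
  have FE : F n w = u n * (G w / c).
    by rewrite /u /F -mulrA; congr (_ * _); rewrite mulrC divfK// gt_eqF.
  have hF : `|m * F n w - std_normal_cdf (w / sd)| <= C1 * (s0^-1 + n.+1%:R^-1).
    exact: (clt _ _ s01 F0 FS n w).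
  have /andP[g0 g1] := G01 w.
  have : `|(m * u n - 1) * (G w / c)| <= C2 / n.+1%:R.
    by rewrite normrM -[leRHS]mulr1 ler_pM// ger0_norm.
  move: un hF; rewrite FE.
  have := ler_normB (m * (u n * (G w / c)) - std_normal_cdf (w / sd))
    ((m * u n - 1) * (G w / c)).
  move: (C1 * (s0^-1 + n.+1%:R^-1)) (C2 / n.+1%:R) m (u n) (std_normal_cdf _) (G w / c).
  move=> v e M U P g.
  have -> : M * (U * g) - P - (M * U - 1) * g = g - P by lra.
  lra.
pose v := sg * n%:R; have v0 : 0 < v by rewrite mulr_gt0// ltr0n.
have sv0 : 0 < Num.sqrt v by rewrite sqrtr_gt0.
pose w := x * Num.sqrt v.
have sdv : Num.sqrt v <= sd by rewrite ler_wsqrtr// lerDr sqr_ge0.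
have sd0 : 0 < sd := lt_le_trans sv0 sdv.
have PE : uniform_on R (compositions S n)
     [set l | (ln (prodparts l)%:R - a * n%:R) / Num.sqrt v <= x] =
   (\sum_(y <- map W (L n)) (y <= w)%R%:R) / c.
  rewrite uniform_on_comp//; congr (_ / _); rewrite big_map big_seq [RHS]big_seq.
  apply: eq_bigr => l; rewrite mem_comp_seq// => /set_mem lS.
  congr (_%:R); congr nat_of_bool.
  rewrite /W (sum_parts_ln a S_pos lS); apply/idP/idP => [/set_mem|] /=.
    by rewrite ler_pdivrMr.
  by move=> h1; apply/mem_set; rewrite /= ler_pdivrMr.
have /= := std_normal_smoothing (map W (L n)) w h0 s00.
rewrite -[std_normal_cdf x](_ : std_normal_cdf (w / Num.sqrt v) = _); last first.
  by rewrite /w mulfK// gt_eqF.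
rewrite -/v PE !big_map size_map -/c; set t := 8 / _.
rewrite -/(G (w - h)) -/(G (w + h)) => /andP[lo hi].
set P := \sum_(j <- L n) _ in lo hi *.
have hh : h / sd <= h / Num.sqrt v by rewrite ler_pM2l// lef_pV2 ?posrE.
have lip z : `|std_normal_cdf ((w + z) / sd) - std_normal_cdf (w / sd)| <= `|z| / sd.
  by rewrite (le_trans (std_normal_cdf_lip _ _))// -mulrBl addrC addKr normrM
    (gtr0_norm (_ : 0 < sd^-1)) ?invr_gt0.
have := lip h; have := lip (- h); rewrite normrN (gtr0_norm h0).
have := GA (w + h); have := GA (w - h).
have := std_normal_cdf_rescale w v0 (sqr_ge0 s0); rewrite -/sd.
have : P / c <= G (w + h) / c + t.
  by rewrite ler_pdivrMr// mulrDl divfK// gt_eqF.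
have : G (w - h) / c - t <= P / c.
  by rewrite ler_pdivlMr// mulrBl divfK// gt_eqF.
move: hh; move: (h / sd) (h / _) (P / c) (G _ / c) (G _ / c) => ? ? ? ? ?.
move: (std_normal_cdf _) (std_normal_cdf _) (std_normal_cdf _) (std_normal_cdf _) => ? ? ? ?.
move: (C2 / _) (C1 * _) (_ / v) => ? ? ?.
rewrite !ler_norml => ? ? ? /andP[? ?] /andP[? ?] /andP[? ?] /andP[? ?] /andP[? ?].
lra.
Qed.

Theorem theorem1 (R : realType) (S : set nat) (hS : proper_cofinite S) :
  exists (a1 a0 b1 b0 : R) (mu sigma : nat -> R),
    [/\ 0 < a1 /\ 0 < b1,
        forall n, 0 < sigma n,
        mu n - (a1 * n%:R + a0) @[n --> \oo] --> 0,
        sigma n ^+ 2 - (b1 * n%:R + b0) @[n --> \oo] --> 0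
      & exists C : R, \forall n \near \oo, forall x : R,
          `|x| <= Num.sqrt n%:R ->
          `| uniform_on R (compositions S n)
               [set l | (ln (prodparts l)%:R - mu n) / sigma n <= x]
             - std_normal_cdf x |
          <= C * (ln n%:R `^ 3^-1 / n%:R `^ 6^-1)].
Proof.
case: hS => S_pos S_fin _.
have [K K0 SK] := cofinite_bound S_fin.
have [r r01 rr] := part_weight_root R S_pos K0.
have [a [sg [a0 sg0 Yle EY EY2]]] := part_weight_drift S_pos K0 SK r01 rr.
have [C1 [C2 [C10 C20 bnd]]] := comp_kolmogorov S_pos K0 SK r01 rr a0 sg0 Yle EY EY2.
(* [sigma] is 1 at [n = 0], where the square root vanishes, to stay positive everywhere. *)
exists a, 0, sg, 0, (fun n => a * n%:R),
  (fun n => if n == 0%N then 1 else Num.sqrt (sg * n%:R)).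
split=> //.
- by case=> [|n]/=; rewrite ?ltr01// sqrtr_gt0 mulr_gt0.
- by under eq_fun do rewrite addr0 subrr; exact: cvg_cst.
- apply: cvg_near_cst; near=> n.
  have n0 : (0 < n)%N by near: n; exact: nbhs_infty_gt.
  by rewrite gtn_eqF// addr0 sqr_sqrtr ?subrr// mulr_ge0// ltW.
have isg : 0 < sg^-1 by rewrite invr_gt0.
(* One summand per error term of [comp_kolmogorov]; [C1] counts twice since it multiplies two
   inverses. *)
pose C3 := C2 + 2 * C1 + 8 + (Num.sqrt sg)^-1 + sg^-1.
have C30 : 0 <= C3.
  by rewrite !addr_ge0 ?mulr_ge0// ?invr_ge0 ?sqrtr_ge0// ltW.
exists C3; near=> n => x _.
have n0 : (0 < n)%N by near: n; exact: nbhs_infty_gt.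
have nC2 : C2 < n.+1%:R.
  have : C2 < n%:R by near: n; exact: nbhs_infty_gtr.
  by move=> /lt_le_trans; apply; rewrite ler_nat.
have nR : 1 <= n%:R :> R by rewrite ler1n.
(* With s0 = A^3 and h = A^4 each of the five error terms is O(A^-2). *)
pose A := (n%:R : R) `^ 12^-1.
have A0 : 0 < A by rewrite powR_gt0// ltr0n.
have A1 : 1 <= A by rewrite -(powRr0 n%:R) ler_powR.
have A12 : A ^+ 12 = n%:R by rewrite -powR_mulrn ?ltW// -powRrM mulVf// powRr1.
have A2 : n%:R `^ 6^-1 = A ^+ 2.
  rewrite -powR_mulrn ?ltW// -powRrM; congr (_ `^ _); lra.
(* For [n >= e] the logarithmic factor is at least 1, so a bound by [C3 / A ^+ 2] is enough. *)
have ln1 : 1 <= (ln n%:R : R) `^ 3^-1.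
  have e1 : 1 <= ln n%:R :> R.
    rewrite -ler_expR lnK ?posrE ?ltr0n//.
    by near: n; exact: nbhs_infty_ger.
  by rewrite -[leLHS](powRr0 (ln (n%:R : R))) ler_powR.
rewrite gtn_eqF// A2.
suff : `|uniform_on R (compositions S n)
    [set l | (ln (prodparts l)%:R - a * n%:R) / Num.sqrt (sg * n%:R) <= x] - std_normal_cdf x|
    <= C3 / A ^+ 2.
  by move=> /le_trans; apply; rewrite ler_wpM2l// ler_peMl// invr_ge0 exprn_ge0// ltW.
have s01 : 1 <= A ^+ 3 by rewrite exprn_ege1.
have h0 : 0 < A ^+ 4 by rewrite exprn_gt0.
apply: (le_trans (bnd _ _ n x s01 h0 n0 nC2)).
pose i := A^-1.
have i0 : 0 < i by rewrite invr_gt0.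
have i1 : i <= 1 by rewrite invf_le1.
have iA : i * A = 1 by rewrite mulVf// gt_eqF.
have iX j : (2 <= j)%N -> i ^+ j <= i ^+ 2 by move=> h; rewrite ler_wiXn2l// ltW.
have e1 : n.+1%:R^-1 <= i ^+ 2.
  apply: le_trans (iX 12%N isT); rewrite exprVn A12 lef_pV2 ?posrE ?ltr0n//.
  by rewrite ler_nat.
have e2 : (A ^+ 3)^-1 <= i ^+ 2 by rewrite -exprVn; exact: iX.
have e3 : 8 / (A ^+ 4 / A ^+ 3) ^+ 2 = 8 * i ^+ 2.
  by rewrite [A ^+ 4]exprS mulfK ?exprVn// expf_neq0// gt_eqF.
have e4 : A ^+ 4 / Num.sqrt (sg * n%:R) = (Num.sqrt sg)^-1 * i ^+ 2.
  rewrite sqrtrM ?(ltW sg0)// -A12 (exprM A 6 2) sqrtr_sqr ger0_norm ?exprn_ge0 ?(ltW A0)//.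
  rewrite invfM mulrCA; congr (_ * _).
  by rewrite (exprD A 4 2) invfM mulrA divff ?mul1r ?exprVn// expf_neq0// gt_eqF.
have e5 : (A ^+ 3) ^+ 2 / (sg * n%:R) <= sg^-1 * i ^+ 2.
  rewrite -A12 invfM mulrCA ler_wpM2l ?(ltW isg)// -exprM (exprD A 6 6) invfM mulrA.
  rewrite divff ?mul1r ?expf_neq0 ?gt_eqF// -exprVn; exact: iX.
rewrite e3 e4 -(exprVn A 2) -/i.
have := ler_wpM2l C20 e1; have := ler_wpM2l C10 e1; have := ler_wpM2l C10 e2.
move: e5; rewrite /C3.
move: (Num.sqrt sg)^-1 sg^-1 n.+1%:R^-1 (A ^+ 3)^-1 (_ / (sg * _)) (i ^+ 2) => ? ? ? ? ? ?.
lra.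
Unshelve. all: by end_near. Qed.
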